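(* Let $(G,\mathsf X)$ be a contracting self-similar group. If $I_{\mathrm{ess}}^{\mathrm{alg}}(G,\mathsf X)\neq0$, then there are some $w\in\mathsf X^+$ and $0\neq a\in\mathbb CH_w$ with $a\in I_{\mathrm{ess}}^{\mathrm{alg}}(G,\mathsf X)$ (that is, the image of $a$ in $\mathbb C(G,\mathsf X)$ under $g\mapsto\mathsf u_g$ lies in $I_{\mathrm{ess}}^{\mathrm{alg}}(G,\mathsf X)$).
   Context: Self-similar groups. $\mathsf X$ is a finite set; $\mathsf X^*$ (resp. $\mathsf X^+$) is the set of finite (resp. finite nonempty) words, $\mathsf X^\omega$ the set of infinite words with metric $d(u,v)=2^{-|u\wedge v|}$, $u\wedge v$ being the longest common prefix. $G$ is a discrete group acting faithfully on $\mathsf X^\omega$ by isometries; this induces an action on $\mathsf X^*$. $(G,\mathsf X)$ is self-similar if for all $g\in G$, $\mathsf x\in\mathsf X$ there is a (unique) $g|_{\mathsf x}\in G$ with $g(\mathsf xw)=g(\mathsf x)\,g|_{\mathsf x}(w)$ for all $w\in\mathsf X^\omega$. Put $g|_\emptyset=g$, $g|_{\mathsf xu}=(g|_{\mathsf x})|_u$. $(G,\mathsf X)$ is contracting if there is a finite $N\subseteq G$ with (a) $n|_{\mathsf x}\in N$ for all $n\in N,\mathsf x\in\mathsf X$; (b) for all $g\in G$ there is $m\ge0$ with $g|_w\in N$ for all $w\in\mathsf X^m$. For $w\in\mathsf X^+$, $H_w=\{g\in G:g(w)=w,\ g|_w=g\}$, a finite subgroup of $G$, and $\mathbb CH_w$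 is its group algebra. Algebras. $\mathbb C(G,\mathsf X)$ is the universal unital complex $*$-algebra generated by $\{\mathsf u_g:g\in G\}\cup\{s_{\mathsf x}:\mathsf x\in\mathsf X\}$ subject to: (1) $g\mapsto\mathsf u_g$ is a unitary representation of $G$; (2) $\mathsf u_gs_{\mathsf x}=s_{g(\mathsf x)}\mathsf u_{g|_{\mathsf x}}$; (CK1) $s_{\mathsf x}^*s_{\mathsf y}=\delta_{\mathsf x,\mathsf y}$; (CK2) $\sum_{\mathsf x}s_{\mathsf x}s_{\mathsf x}^*=1$. $\mathcal O(G,\mathsf X)$ is the universal $C^*$-algebra with the same generators and relations. Groupoid. $S(G,\mathsf X)$ is the inverse semigroup with zero given by the generators above and relations (1), (2), (CK1) (with $s_{\mathsf x}^*s_{\mathsf y}=0$ for $\mathsf x\neq\mathsf y$); its nonzero elements are uniquely of the form $s_v\mathsf u_gs_w^*$, acting on $\mathsf X^\omega$ as the partial homeomorphism $w\rho\mapsto v\,g(\rho)$ with domain $w\mathsf X^\omega$. $\mathcal G(G,\mathsf X)$ is the groupoid of germs $[s,\rho]$ of this action, an ample (possibly non-Hausdorff) groupoid with unit space $\mathsf X^\omega$ whose topology has basis the sets $\{[s,\rho]:\rho\in U\}$, $U$ open in the domain of $s$. For an ample groupoid $\mathcal G$, $\mathbb C\mathcal G$ is the convolution algebra spanned by indicator functions of compact open bisections, and $C^*_r(\mathcal G)$ is its completion in $\|a\|=\sup_x\|\lambda_x(a)\|$, where $\lambda_x$ is the left-convolution representation on $\ell^2(\mathcal G_x)$, $\mathcal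 G_x=\mathsf s^{-1}(x)$. For $(G,\mathsf X)$ contracting there are canonical isomorphisms $\mathbb C(G,\mathsf X)\cong\mathbb C\mathcal G(G,\mathsf X)$ and $\mathcal O(G,\mathsf X)\cong C^*_r(\mathcal G(G,\mathsf X))$, sending $\mathsf u_g$ and $s_{\mathsf x}$ to the indicator functions of the sets of germs of $w\mapsto g(w)$ and $w\mapsto\mathsf xw$; these are used as identifications. Essential ideals. Elements $a\in C^*_r(\mathcal G)$ are regarded as bounded functions on $\mathcal G$ via $a(\gamma)=\langle\lambda_x(a)\delta_x,\delta_\gamma\rangle$, $x=\mathsf s(\gamma)$; the strict support of $a$ is $\{\gamma:a(\gamma)\neq0\}$. $I_{\mathrm{ess}}(G,\mathsf X)$ is the ideal of all $a\in C^*_r(\mathcal G(G,\mathsf X))$ whose strict support has empty interior, and $I^{\mathrm{alg}}_{\mathrm{ess}}(G,\mathsf X)=I_{\mathrm{ess}}(G,\mathsf X)\cap\mathbb C(G,\mathsf X)$. *)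

(* Defs.v *)
From HB Require Import structures.
From mathcomp Require Import all_boot all_order all_algebra.
From mathcomp Require Import complex finmap.
From mathcomp Require Import all_classical all_reals all_analysis.

Set Implicit Arguments.
Unset Strict Implicit.
Unset Printing Implicit Defensive.

Import Order.TTheory GRing.Theory Num.Theory.
Local Open Scope classical_set_scope.
Local Open Scope ring_scope.

Definition omega (X : finType) : Type := nat -> X.

Section Words.
Variable X : finType.
Implicit Types (u v : omega X) (w : seq X) (x : X) (n : nat).

(* 2 ^ - |u /\ v|: the least index at which u and v differ is the length of
   their longest common prefix. *)
Definition odist u v : rat :=
  if pselect (exists n, u n != v n) is left h then 2 ^- (ex_minn h) else 0.

Definition ocat w u : omega X :=
  fun i => if (i < size w)%N then nth (u 0%N) w i else u (i - size w)%N.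

Definition odrop n u : omega X := fun i => u (n + i)%N.

Lemma odistxx u : odist u u = 0.
Proof.
by rewrite /odist; case: pselect => // h; exfalso; case: h => n; rewrite eqxx.
Qed.

Lemma odist_ge0 u v : 0 <= odist u v.
Proof. by rewrite /odist; case: pselect => // h; rewrite invr_ge0 exprn_ge0. Qed.

Lemma odist_pos u v : odist u v = 0 -> u = v.
Proof.
rewrite /odist; case: pselect => [h /eqP|h _].
  by rewrite invr_eq0 expf_eq0 pnatr_eq0 andbF.
apply/funext => n; apply/eqP; apply: contrapT => /negP unv.
by apply: h; exists n.
Qed.

Lemma odist_sym u v : odist u v = odist v u.
Proof.
rewrite /odist; case: pselect => h; case: pselect => h' //.
- congr (2 ^- _); case: ex_minnP => m um mm; case: ex_minnP => k uk kk.
  by apply/eqP; rewrite eqn_leq mm 1?kk // eq_sym.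
- by case: h' ; case: h => n ?; exists n; rewrite eq_sym.
- by case: h ; case: h' => n ?; exists n; rewrite eq_sym.
Qed.

Lemma odist_le u v n : u n != v n -> 2 ^- n <= odist u v.
Proof.
move=> unv; rewrite /odist; case: pselect => [h|[]]; last by exists n.
case: ex_minnP => m _ /(_ _ unv) mn.
by rewrite lef_pV2 ?posrE ?exprn_gt0// ler_eXn2l// ltr1n.
Qed.

Lemma odist_triangle v u t : odist u t <= odist u v + odist v t.
Proof.
have := erefl (odist u t); rewrite {1}/odist; case: pselect => [h|_] <-; last first.
  by rewrite addr_ge0 ?odist_ge0.
case: ex_minnP => n unt _.
have [uv|uv] := eqVneq (u n) (v n).
  rewrite uv in unt; apply: le_trans (odist_le unt) _.
  by rewrite lerDr odist_ge0.
by apply: le_trans (odist_le uv) _; rewrite lerDl odist_ge0.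
Qed.

HB.instance Definition _ := gen_eqMixin (omega X).
HB.instance Definition _ := gen_choiceMixin (omega X).
(* Distances lie in {0} \cup {2^-n}, so rat is used as the field of values. *)
HB.instance Definition _ := isMetric.Build rat (omega X)
  odistxx odist_pos odist_sym odist_triangle.

End Words.

Record selfSimilar (G : groupType) (X : finType) := SelfSimilar {
  act : G -> omega X -> omega X;
  act1 : forall r, act 1%g r = r;
  actM : forall g h r, act (g * h)%g r = act g (act h r);
  act_faithful : forall g, (forall r, act g r = r) -> g = 1%g;
  act_isometry : forall g (u v : omega X),
    mdist (act g u) (act g v) = mdist u v;
  act_selfsimilar : forall g x, exists h, exists y, forall r,
    act g (ocat [:: x] r) = ocat [:: y] (act h r)
}.

Section SelfSimilar.
Variables (G : groupType) (X : finType) (A : selfSimilar G X).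
Implicit Types (g h : G) (v w : seq X) (x y : X) (r : omega X).

(* g(w): the prefix of length |w| of g(w r), which by isometry does not depend
   on r; the constant tail is only used to have some r at hand. *)
Definition actw g w : seq X :=
  if w is x :: _ then mkseq (act A g (ocat w (fun=> x))) (size w) else [::].

Definition restr1 g x : G := sval (cid (act_selfsimilar A g x)).

Definition restr g w : G := foldl restr1 g w.

Definition contracting : Prop :=
  exists N : set G,
    [/\ finite_set N,
        (forall n x, N n -> N (restr1 n x)) &
        (forall g, exists m : nat, forall w, size w = m -> N (restr g w))].

Definition Hgrp w : set G := [set g | actw g w = w /\ restr g w = g].

(* Some (v, g, w) is s_v u_g s_w^*, and None is 0. *)
Definition isg : Type := option (seq X * G * seq X).

Implicit Types s t e : isg.

Definition isg1 : isg := Some ([::], 1%g, [::]).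
Definition isgu g : isg := Some ([::], g, [::]).
Definition isgs x : isg := Some ([:: x], 1%g, [::]).

(* With z the remaining suffix, and adjoints written as ', the products are
     s_v u_g s_w' . s_(w z) u_h s_t' = s_(v g(z)) u_(g|_z h) s_t'
     s_v u_g s_(w z)' . s_w u_h s_t' = s_v u_(g k^-1) s_(t h^-1(z))'
   where k = h^-1|_z. *)
Definition isgM s t : isg :=
  match s, t with
  | Some (v, g, w), Some (v', h, t) =>
    if prefix w v' then
      let z := drop (size w) v' in
      Some (v ++ actw g z, (restr g z * h)%g, t)
    else if prefix v' w then
      let z := drop (size v') w in
      Some (v, (g * (restr h^-1 z)^-1)%g, t ++ actw h^-1%g z)
    else None
  | _, _ => None
  end.

Definition isgV s : isg :=
  if s is Some (v, g, w) then Some (w, g^-1%g, v) else None.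

Definition idom s : set (omega X) :=
  if s is Some (_, _, w) then [set ocat w r | r in setT] else set0.

Definition iact s r : omega X :=
  if s is Some (v, g, w) then ocat v (act A g (odrop (size w) r)) else r.

(* Germs of an action of an inverse semigroup: (s, r) and (t, r') have the same
   germ iff r = r' and s e = t e for some idempotent e whose domain contains r. *)
Definition same_germ (p q : isg * omega X) : Prop :=
  p.2 = q.2 /\
  exists e, [/\ isgM e e = e, idom e p.2 & isgM p.1 e = isgM q.1 e].

Definition germ_class (p : isg * omega X) : set (isg * omega X) :=
  [set q | idom q.1 q.2 /\ same_germ p q].

Definition germs : Type := {c : set (isg * omega X) |
  exists p, idom p.1 p.2 /\ c = germ_class p}.

Lemma idom1 r : idom isg1 r.
Proof. by exists r => //; apply/funext => i; rewrite /ocat/= subn0. Qed.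

(* [s, r]; the value when r is outside the domain of s is a junk value. *)
Definition germ s r : germs :=
  if pselect (idom s r) is left h then
    exist _ (germ_class (s, r)) (ex_intro _ (s, r) (conj h erefl))
  else exist _ (germ_class (isg1, r))
         (ex_intro _ (isg1, r) (conj (idom1 r) erefl)).

Definition grep (c : germs) : isg * omega X := sval (cid (svalP c)).

Definition gsrc (c : germs) : omega X := (grep c).2.
Definition grng (c : germs) : omega X := iact (grep c).1 (grep c).2.
Definition gunit r : germs := germ isg1 r.

(* [s, t r] [t, r] = [s t, r]; only meaningful when gsrc c = grng d. *)
Definition gmul (c d : germs) : germs :=
  germ (isgM (grep c).1 (grep d).1) (gsrc d).
Definition ginv (c : germs) : germs := germ (isgV (grep c).1) (grng c).

Definition gslice s (U : set (omega X)) : set germs := [set germ s r | r in U].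

HB.instance Definition _ := gen_eqMixin germs.
HB.instance Definition _ := gen_choiceMixin germs.
(* The sets gslice s U form a basis, so the topology they generate as a subbase
   is the one of which they are a basis. *)
HB.instance Definition _ := isSubBaseTopological.Build germs
  [set B | exists s U, [/\ open U, U `<=` idom s & B = gslice s U]] id.

Definition fiber r : set germs := [set c | gsrc c = r].

Definition bisection (B : set germs) : Prop :=
  {in B &, injective gsrc} /\ {in B &, injective grng}.

Variable R : realType.
Local Notation C := (R[i]).
Implicit Types (a b f : germs -> C).

Definition convalg : set (germs -> C) :=
  [set a | exists n (c : 'I_n -> C) (B : 'I_n -> set germs),
    (forall i, [/\ compact (B i), open (B i) & bisection (B i)]) /\
    a = fun d => \sum_(i < n) c i * \1_(B i) d].

(* lambda_r; only the values on fiber r are relevant, and there the sum has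
   finitely many nonzero terms when a is in convalg. *)
Definition lreg a r f : germs -> C :=
  fun c => \sum_(d \in fiber r) a (gmul c (ginv d)) * f d.

Definition conv a b : germs -> C := fun c => lreg a (gsrc c) b c.
Definition gstar a : germs -> C := fun c => (a (ginv c))^*%C.

Definition l2norm r f : \bar R :=
  (sqrte (\esum_(c in fiber r) (complex.Re `|f c| ^+ 2)%:E))%E.

(* Families (T_r)_r of operators on the Hilbert spaces l^2(fiber r), of which
   the direct sum of the representations lreg is an instance. An element of
   l^2(fiber r) is represented by its extension by 0 to all germs; the values of
   T_r on other functions, and of T_r f outside of fiber r, are irrelevant. *)
Definition opfam : Type := omega X -> (germs -> C) -> (germs -> C).

Definition opnorm (T : opfam) : \bar R :=
  ereal_sup [set y | exists r f, [/\ (forall c, ~ fiber r c -> f c = 0),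
    (l2norm r f <= 1)%E & y = l2norm r (T r f)]].

(* C*_r: the closure, for the norm sup_r |T_r|, of the image of convalg *)
Definition redCstar : set opfam :=
  [set T | forall eps : R, 0 < eps -> exists2 a, convalg a &
    (opnorm (fun r f c => T r f c - lreg a r f c)%R <= eps%:E)%E].

(* T(c) = < T_r delta_r, delta_c > with r = s(c), the inner product with delta_c
   being evaluation at c *)
Definition opfun (T : opfam) : germs -> C :=
  fun c => T (gsrc c) \1_[set gunit (gsrc c)] c.

Definition Iess : set opfam :=
  [set T | redCstar T /\ interior [set c | opfun T c != 0] = set0].

(* Expressions in the generators; C(G,X) is the set of expressions modulo the
   least congruence cgx_eq satisfying the axioms of unital complex *-algebras
   and the defining relations. *)
Inductive cgx : Type :=
| CU of G
| CS of X
| C0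
| C1
| CAdd of cgx & cgx
| CScale of C & cgx
| CMul of cgx & cgx
| CStar of cgx.

Inductive cgx_eq : cgx -> cgx -> Prop :=
| cgx_refl p : cgx_eq p p
| cgx_sym p q : cgx_eq p q -> cgx_eq q p
| cgx_trans q p p' : cgx_eq p q -> cgx_eq q p' -> cgx_eq p p'
| cgx_congrD p p' q q' :
    cgx_eq p p' -> cgx_eq q q' -> cgx_eq (CAdd p q) (CAdd p' q')
| cgx_congrZ k p p' : cgx_eq p p' -> cgx_eq (CScale k p) (CScale k p')
| cgx_congrM p p' q q' :
    cgx_eq p p' -> cgx_eq q q' -> cgx_eq (CMul p q) (CMul p' q')
| cgx_congrV p p' : cgx_eq p p' -> cgx_eq (CStar p) (CStar p')
| cgx_addA p q q' : cgx_eq (CAdd p (CAdd q q')) (CAdd (CAdd p q) q')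
| cgx_addC p q : cgx_eq (CAdd p q) (CAdd q p)
| cgx_add0 p : cgx_eq (CAdd C0 p) p
| cgx_scale0 p : cgx_eq (CScale 0 p) C0
| cgx_scale1 p : cgx_eq (CScale 1 p) p
| cgx_scaleA k l p : cgx_eq (CScale k (CScale l p)) (CScale (k * l) p)
| cgx_scaleDr k p q :
    cgx_eq (CScale k (CAdd p q)) (CAdd (CScale k p) (CScale k q))
| cgx_scaleDl k l p :
    cgx_eq (CScale (k + l) p) (CAdd (CScale k p) (CScale l p))
| cgx_mulA p q q' : cgx_eq (CMul p (CMul q q')) (CMul (CMul p q) q')
| cgx_mul1l p : cgx_eq (CMul C1 p) p
| cgx_mul1r p : cgx_eq (CMul p C1) p
| cgx_mulDl p q q' :
    cgx_eq (CMul (CAdd p q) q') (CAdd (CMul p q') (CMul q q'))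
| cgx_mulDr p q q' :
    cgx_eq (CMul p (CAdd q q')) (CAdd (CMul p q) (CMul p q'))
| cgx_scaleAl k p q : cgx_eq (CMul (CScale k p) q) (CScale k (CMul p q))
| cgx_scaleAr k p q : cgx_eq (CMul p (CScale k q)) (CScale k (CMul p q))
| cgx_starK p : cgx_eq (CStar (CStar p)) p
| cgx_starD p q : cgx_eq (CStar (CAdd p q)) (CAdd (CStar p) (CStar q))
| cgx_starZ k p : cgx_eq (CStar (CScale k p)) (CScale (k^*)%C (CStar p))
| cgx_starM p q : cgx_eq (CStar (CMul p q)) (CMul (CStar q) (CStar p))
| cgx_u1 : cgx_eq (CU 1%g) C1
| cgx_uM g h : cgx_eq (CU (g * h)%g) (CMul (CU g) (CU h))
| cgx_uVl g : cgx_eq (CMul (CStar (CU g)) (CU g)) C1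
| cgx_uVr g : cgx_eq (CMul (CU g) (CStar (CU g))) C1
| cgx_us g x :
    cgx_eq (CMul (CU g) (CS x)) (CMul (CS (head x (actw g [:: x]))) (CU (restr1 g x)))
| cgx_CK1 x : cgx_eq (CMul (CStar (CS x)) (CS x)) C1
| cgx_CK1' x y : x <> y -> cgx_eq (CMul (CStar (CS x)) (CS y)) C0
| cgx_CK2 :
    cgx_eq (\big[CAdd/C0]_(x <- enum X) CMul (CS x) (CStar (CS x))) C1.

(* The canonical isomorphism from C(G,X) to the convolution algebra *)
Fixpoint cgx_fun (p : cgx) : germs -> C :=
  match p with
  | CU g => \1_(gslice (isgu g) setT)
  | CS x => \1_(gslice (isgs x) setT)
  | C0 => fun=> 0
  | C1 => \1_(range gunit)
  | CAdd p q => fun c => cgx_fun p c + cgx_fun q c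
  | CScale k p => fun c => k * cgx_fun p c
  | CMul p q => conv (cgx_fun p) (cgx_fun q)
  | CStar p => gstar (cgx_fun p)
  end.

(* I_ess \cap C(G,X), for C(G,X) embedded in C*_r through cgx_fun *)
Definition Iess_alg : set cgx := [set p | Iess (lreg (cgx_fun p))].

(* The group algebra of G, as finitely supported functions, its subspace CH_w,
   and the map to C(G,X) extending g |-> u_g *)
Definition grpalg : Type := {fsfun G -> C with 0}.

Definition CH w : set grpalg := [set a : grpalg | forall g, a g != 0 -> Hgrp w g].

Definition grpalg_cgx (a : grpalg) : cgx :=
  \big[CAdd/C0]_(g <- finsupp a) CScale (a g) (CU g).

End SelfSimilar.

(* Main.v *)
From HB Require Import structures.
From mathcomp Require Import all_boot all_order all_algebra finmap complex.
From mathcomp Require Import all_classical all_reals all_analysis.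
From mathcomp Require Import zify.
Require Import Defs.

Set Implicit Arguments.
Unset Strict Implicit.
Unset Printing Implicit Defensive.

Import Order.TTheory GRing.Theory Num.Theory.
Local Open Scope classical_set_scope.
Local Open Scope ring_scope.

(* Say that a finite formal sum b of elements of G is singular if its image in
   C(G,X) is a nonzero element of I_ess.  If f is a nonzero element of
   I_ess \cap C(G,X) and n is large, then every f s_w with |w| = n lies in the
   sum of the s_v CG, and by (CK2) one of the components s_v b is nonzero; b is
   singular because it is, up to an open embedding of groupoids, a restriction
   of f.  In the same way every singular b has, for each n, a singular
   "restriction" s_v^* b s_w with |w| = n, which by contraction is supported in
   the nucleus for n large.  Take b singular, supported in the nucleus, with as
   few terms as possible.  Restricting b to suitable letters never loses a term,
   so all g in b map w to the same v and the new terms are the g|_w; by the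
   pigeonhole principle the list of group elements eventually repeats.  This
   gives w nonempty with g(w) = v and g|_w = g for all g in b, and translating b
   on the left by the inverse of one of its terms moves it into CH_w. *)

(** * Words and the action *)

Section InfiniteWords.
Variable X : finType.
Implicit Types (r : omega X) (v w : seq X).

Definition pref n r : seq X := mkseq r n.

Lemma size_pref n r : size (pref n r) = n.
Proof. by rewrite size_mkseq. Qed.

Lemma ocat_nil r : ocat [::] r = r.
Proof. by apply/funext => i; rewrite /ocat /= subn0. Qed.

Lemma ocat_cat v w r : ocat (v ++ w) r = ocat v (ocat w r).
Proof.
apply/funext => i; rewrite /ocat size_cat nth_cat.
case: (ltnP i (size v)) => iv.
  by rewrite (leq_trans iv) ?leq_addr//; apply: set_nth_default.
rewrite subnDA ltn_subLR//; case: ltnP => // iw.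
Qed.

Lemma pref_ocat w r : pref (size w) (ocat w r) = w.
Proof.
apply: (@eq_from_nth _ (r 0%N)); rewrite size_mkseq// => i iw.
by rewrite nth_mkseq// /ocat iw; apply: set_nth_default.
Qed.

Lemma odrop_ocat w r : odrop (size w) (ocat w r) = r.
Proof.
by apply/funext => i; rewrite /odrop /ocat ltnNge leq_addr /= addKn.
Qed.

Lemma ocat_pref n r : ocat (pref n r) (odrop n r) = r.
Proof.
apply/funext => i; rewrite /odrop /ocat size_mkseq; case: ltnP => // ni.
  by rewrite nth_mkseq.
by rewrite subnKC.
Qed.

Lemma ocat_inj v w r r' : size v = size w -> ocat v r = ocat w r' ->
  v = w /\ r = r'.
Proof.
move=> vw e; split.
  by rewrite -[LHS](pref_ocat v r) e vw pref_ocat.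
by rewrite -[LHS](odrop_ocat v r) e vw odrop_ocat.
Qed.

Lemma ocat_prefix v w r r' : (size v <= size w)%N -> ocat v r = ocat w r' ->
  exists2 z, w = v ++ z & r = ocat z r'.
Proof.
move=> vw; rewrite -{1}(cat_take_drop (size v) w) ocat_cat => e.
have [|e1 e2] := ocat_inj _ e; first by rewrite size_takel.
by exists (drop (size v) w) => //; rewrite {1}e1 cat_take_drop.
Qed.

(** Cylinders are a neighbourhood basis: the ball of radius e contains the cylinder of any n with
    2^-n < e, and the ball of radius 2^-n lies in the cylinder of length n. Continuity and openness
    statements thereby become statements about prefixes. *)
Lemma nbhs_omegaP r (B : set (omega X)) :
  nbhs r B <-> exists n, forall r', B (ocat (pref n r) r').
Proof.
split.
  move/nbhs_ballP => [e /= e0 eB].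
  have [n ne] : exists n, 2 ^- n < e :> rat.
    have /archi_boundP : 0 <= e^-1 by rewrite invr_ge0 ltW.
    set n := Num.bound _ => en; exists n.
    rewrite invf_plt ?posrE ?exprn_gt0//; apply: lt_trans en _.
    by rewrite -natrX ltr_nat ltn_expl.
  exists n => r'; apply: eB; rewrite ballEmdist /=.
  apply: le_lt_trans ne; rewrite /mdist /= /odist.
  case: pselect => // h; case: ex_minnP => m + _ => um.
  rewrite lef_pV2 ?posrE ?exprn_gt0// ler_eXn2l ?ltr1n//.
  rewrite leqNgt; apply: contra um => mn.
  by rewrite /ocat size_mkseq mn nth_mkseq.
move=> [n nB]; apply/nbhs_ballP; exists (2 ^- n) => /=.
  by rewrite invr_gt0 exprn_gt0.
move=> r'; rewrite ballEmdist /= => rr'.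
rewrite -(ocat_pref n r').
have -> : pref n r' = pref n r; last exact: nB.
apply/eq_in_map => i; rewrite mem_iota /= add0n => ilt.
apply/eqP; apply: contraLR rr' => ne.
rewrite -leNgt; apply: le_trans (odist_le (n := i) _); last by rewrite eq_sym.
by rewrite lef_pV2 ?posrE ?exprn_gt0// ler_eXn2l ?ltr1n// ltnW.
Qed.

(** An ultrafilter selects a letter at each position because X is finite. The selected letters form
    its limit, since a cylinder constrains only finitely many positions. *)
Lemma compact_omega : compact [set: omega X].
Proof.
rewrite compact_ultra => F UF _.
have H n : exists x, F [set r : omega X | r n = x].
  apply: contrapT => /forallNP nF.
  (* If no letter were selected, the finitely many complements would meet in a member of F whose
     words have no letter at position n. *)
  have : F [set r : omega X | forall x, r n <> x].
    apply: (@filter_forall _ _ (fun x (r : omega X) => r n <> x)) => x.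
    have [|//] := in_ultra_setVsetC [set r : omega X | r n = x] UF.
    by move=> /nF.
  by move=> /filter_ex[r] /(_ (r n)) /=.
pose u n := sval (cid (H n)).
exists u; split => // B /nbhs_omegaP[n nB].
have : F [set r : omega X | forall i : 'I_n, r i = u i].
  apply: (@filter_forall _ _ (fun (i : 'I_n) (r : omega X) => r i = u i)) => i.
  by rewrite /u; case: cid.
apply: filterS => r ru; rewrite -(ocat_pref n r).
have -> : pref n r = pref n u; last exact: nB.
by apply/eq_in_map => i; rewrite mem_iota /= add0n => ilt; exact: (ru (Ordinal ilt)).
Qed.

Lemma continuous_ocat w : continuous (ocat w : omega X -> omega X).
Proof.
move=> r B /nbhs_omegaP[n nB]; apply/nbhs_omegaP; exists n => r' /=.
set q := ocat w _; rewrite -(ocat_pref n q).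
have -> : pref n q = pref n (ocat w r); last exact: nB.
apply/eq_in_map => i; rewrite mem_iota /= add0n => ilt; rewrite /q {1 3}/ocat.
case: ltnP => iw; first exact: set_nth_default.
have wn := leq_ltn_trans (leq_subr (size w) i) ilt.
by rewrite /ocat size_pref wn nth_mkseq.
Qed.

Lemma continuous_odrop n : continuous (odrop n : omega X -> omega X).
Proof.
move=> r B /nbhs_omegaP[m mB]; apply/nbhs_omegaP; exists (n + m)%N => r' /=.
have -> : pref (n + m) r = pref n r ++ pref m (odrop n r).
  rewrite /pref /mkseq iotaD map_cat; congr cat.
  by rewrite add0n -{1}[n]addn0 iotaDl -map_comp.
by rewrite ocat_cat -{1}(size_pref n r) odrop_ocat; apply: mB.
Qed.

Lemma nbhs_ocat w r : nbhs (ocat w r) (range (ocat w)).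
Proof.
apply/nbhs_omegaP; exists (size w) => r'; rewrite pref_ocat.
by exists r'.
Qed.

End InfiniteWords.

Section Action.
Variables (G : groupType) (X : finType) (A : selfSimilar G X).
Implicit Types (g h : G) (v w : seq X) (x y : X) (r : omega X).

Lemma act_ocat_spec w g : exists2 v, size v = size w &
  forall r, act A g (ocat w r) = ocat v (act A (restr A g w) r).
Proof.
elim: w g => [|x w IH] g; first by exists [::] => // r; rewrite !ocat_nil.
have [v vw vE] := IH (restr1 A g x).
have := svalP (cid (act_selfsimilar A g x)); rewrite -/(restr1 A g x) => -[y yE].
exists (y :: v); first by rewrite /= vw.
by move=> r; rewrite -cat1s ocat_cat yE vE -ocat_cat.
Qed.

Lemma act_ocat g w r : act A g (ocat w r) = ocat (actw A g w) (act A (restr A g w) r).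
Proof.
have [v vw vE] := act_ocat_spec w g; rewrite vE; congr ocat.
case: w vw vE => [|x w] vw vE /=; first by case: v vw {vE}.
have := pref_ocat v (act A (restr A g (x :: w)) (fun=> x)).
by rewrite -vE vw => {1}<-.
Qed.

Lemma size_actw g w : size (actw A g w) = size w.
Proof. by case: w => // x w; rewrite size_mkseq. Qed.

Lemma act_eq g h : (forall r, act A g r = act A h r) -> g = h.
Proof.
move=> gh; apply: (@mulgI _ h^-1%g); rewrite mulVg; apply: (act_faithful (s := A)) => r.
by rewrite actM gh -actM mulVg act1.
Qed.

Lemma actVK g r : act A g^-1%g (act A g r) = r.
Proof. by rewrite -actM mulVg act1. Qed.

(** Faithfulness in the form used for the cocycle identities below: to identify words and group
    elements it suffices to compare the maps they define. *)
Lemma ocat_act_inj v w g h : size v = size w ->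
  (forall r, ocat v (act A g r) = ocat w (act A h r)) -> v = w /\ g = h.
Proof.
move=> vw e; split; last first.
  by apply: act_eq => r; have [] := ocat_inj vw (e r).
(* X may be empty, so an infinite word to evaluate at is built from a letter of v; empty words agree
   anyway. *)
case: v w vw e => [|x v] [|y w] // vw e.
by have [] := ocat_inj vw (e (fun=> x)).
Qed.

Lemma actw_restrM g h w :
  actw A (g * h)%g w = actw A g (actw A h w) /\
  restr A (g * h)%g w = (restr A g (actw A h w) * restr A h w)%g.
Proof.
apply: ocat_act_inj; first by rewrite !size_actw.
by move=> r; rewrite -act_ocat !actM !act_ocat.
Qed.

Lemma actw_restr1 w : actw A 1%g w = w /\ restr A 1%g w = 1%g.
Proof.
apply: ocat_act_inj; first by rewrite size_actw.
by move=> r; rewrite -act_ocat !act1.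
Qed.

Lemma restr_cat g v w : restr A g (v ++ w) = restr A (restr A g v) w.
Proof. by rewrite /restr foldl_cat. Qed.

Lemma actw_cat g v w :
  actw A g (v ++ w) = actw A g v ++ actw A (restr A g v) w.
Proof.
suff [] : actw A g (v ++ w) = actw A g v ++ actw A (restr A g v) w /\
          restr A g (v ++ w) = restr A (restr A g v) w by [].
apply: ocat_act_inj => [|r]; first by rewrite size_cat !size_actw size_cat.
by rewrite -act_ocat ocat_cat !act_ocat -ocat_cat.
Qed.

Lemma actwK g w : actw A g (actw A g^-1%g w) = w.
Proof. by rewrite -(actw_restrM _ _ _).1 mulgV (actw_restr1 w).1. Qed.

Lemma actwVK g w : actw A g^-1%g (actw A g w) = w.
Proof. by rewrite -(actw_restrM _ _ _).1 mulVg (actw_restr1 w).1. Qed.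

Lemma restrV g w : restr A g^-1%g (actw A g w) = (restr A g w)^-1%g.
Proof.
apply: (@mulIg _ (restr A g w)).
by rewrite -(actw_restrM _ _ _).2 !mulVg (actw_restr1 w).2.
Qed.

Lemma continuous_act g : continuous (act A g).
Proof.
move=> r B /nbhs_omegaP[n nB]; apply/nbhs_omegaP; exists n => r' /=.
have := nB (act A (restr A g (pref n r)) r').
have -> : pref n (act A g r) = actw A g (pref n r).
  have {1}-> : n = size (actw A g (pref n r)) by rewrite size_actw size_pref.
  by rewrite -{2}(ocat_pref n r) act_ocat pref_ocat.
by rewrite act_ocat.
Qed.

End Action.

(** * Germs as germs of partial maps *)

Section Germs.
Variables (G : groupType) (X : finType) (A : selfSimilar G X).
Implicit Types (g h : G) (v w : seq X) (x y : X) (r : omega X) (s t e : isg G X).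

(** The canonical integer grading. The zero element gets a default value, so additivity is asserted
    only at points in the domain of the product. *)
Definition ideg s : int := if s is Some (v, _, w) then (size v)%:Z - (size w)%:Z else 0.

Lemma idom_ocat v g w r : idom (Some (v, g, w)) (ocat w r).
Proof. by exists r. Qed.

Lemma iact_ocat v g w r :
  iact A (Some (v, g, w)) (ocat w r) = ocat v (act A g r).
Proof. by rewrite /= odrop_ocat. Qed.

Lemma isgM_spec s t r :
  [/\ idom (isgM A s t) r <-> idom t r /\ idom s (iact A t r),
      idom (isgM A s t) r -> iact A (isgM A s t) r = iact A s (iact A t r) &
      idom (isgM A s t) r -> ideg (isgM A s t) = ideg s + ideg t].
Proof.
case: s => [[[v g] w]|]; last by split=> //; split=> // -[].
case: t => [[[v' h] t]|]; last by split=> //; split=> // -[].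
rewrite /isgM; case: ifPn => [/prefixP[z ->]|wv'].
  rewrite drop_size_cat//; split.
  - split; last by case.
    move=> [r' _ <-]; split; first by exists r'.
    rewrite iact_ocat ocat_cat; exact: idom_ocat.
  - move=> [r' _ <-]; rewrite !iact_ocat actM.
    by rewrite (ocat_cat w z) iact_ocat act_ocat ocat_cat.
  - by move=> _; rewrite /= !size_cat size_actw; lia.
case: ifPn => [/prefixP[z wE]|v'w]; last first.
  split => //; split => // -[[r' _ <-]]; rewrite iact_ocat => -[r'' _ e].
  (* Two words with a common infinite extension are comparable for the prefix order, against both
     failed tests. *)
  case/orP: (leq_total (size v') (size w)) => vw.
    have [z zE _] := ocat_prefix vw (esym e).
    by move: v'w; rewrite zE prefix_prefix.
  have [z zE _] := ocat_prefix vw e.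
  by move: wv'; rewrite zE prefix_prefix.
rewrite {}wE drop_size_cat//.
have hz r' : act A h (ocat (actw A h^-1%g z) r') =
    ocat z (act A (restr A h^-1%g z)^-1%g r').
  by rewrite act_ocat actwK -restrV invgK.
split.
- split.
    move=> [r' _ <-]; rewrite ocat_cat; split; first exact: idom_ocat.
    by rewrite iact_ocat hz -ocat_cat; apply: idom_ocat.
  move=> [[r' _ <-]]; rewrite iact_ocat => -[r'' _]; rewrite ocat_cat => e.
  have [//|_ e1] := ocat_inj _ e.
  by rewrite -(actVK A h r') -e1 act_ocat -ocat_cat; apply: idom_ocat.
- move=> [r' _ <-]; rewrite iact_ocat ocat_cat iact_ocat hz -ocat_cat iact_ocat.
  by rewrite actM.
- by move=> _; rewrite /= !size_cat size_actw; lia.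
Qed.

Lemma idomM s t r : idom (isgM A s t) r <-> idom t r /\ idom s (iact A t r).
Proof. by have [] := isgM_spec s t r. Qed.

Lemma iactM s t r : idom (isgM A s t) r ->
  iact A (isgM A s t) r = iact A s (iact A t r).
Proof. by have [] := isgM_spec s t r. Qed.

Lemma idegM s t r : idom (isgM A s t) r -> ideg (isgM A s t) = ideg s + ideg t.
Proof. by have [] := isgM_spec s t r. Qed.

Lemma isgVK s : isgV (isgV s) = s.
Proof. by case: s => [[[v g] w]|] //=; rewrite invgK. Qed.

Lemma idomV s r : idom s r -> idom (isgV s) (iact A s r).
Proof.
by case: s => [[[v g] w]|] //= [r' _ <-]; rewrite odrop_ocat; exists (act A g r').
Qed.

Lemma iactVK s r : idom s r -> iact A (isgV s) (iact A s r) = r.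
Proof.
by case: s => [[[v g] w]|] //= [r' _ <-]; rewrite !odrop_ocat actVK.
Qed.

Lemma iactKV s r : idom (isgV s) r -> iact A s (iact A (isgV s) r) = r.
Proof. by move=> /iactVK; rewrite isgVK. Qed.

Lemma idegV s : ideg (isgV s) = - ideg s.
Proof. by case: s => [[[v g] w]|] //=; rewrite opprB. Qed.

Lemma nbhs_idom s r : idom s r -> nbhs r (idom s).
Proof. by case: s => [[[v g] w]|] //= [r' _ <-]; apply: nbhs_ocat. Qed.

Lemma continuous_iact s : continuous (iact A s).
Proof.
case: s => [[[v g] w]|] r; last by move=> B.
apply: (@continuous_comp _ _ _ (odrop (size w)) (fun q => ocat v (act A g q))).
  exact: continuous_odrop.
by apply: continuous_comp; [exact: continuous_act|exact: continuous_ocat].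
Qed.

Lemma near_iact s r (P : omega X -> Prop) :
  (\forall q \near iact A s r, P q) -> \forall q \near r, P (iact A s q).
Proof. exact: continuous_iact. Qed.

(* Equality of the germs of s and t at r.  As the action is faithful, it amounts
   to local equality of the partial maps; equality of degrees has to be added
   only for the case of a one-letter alphabet. *)
Definition sgerm s t r := [/\ idom s r, idom t r, ideg s = ideg t &
  \forall q \near r, iact A s q = iact A t q].

Lemma sgerm_refl s r : idom s r -> sgerm s s r.
Proof. by move=> sr; split=> //; apply: (@filterE _ (nbhs r)). Qed.

Lemma sgerm_sym s t r : sgerm s t r -> sgerm t s r.
Proof. by case=> sr tr d st; split => //; apply: filterS st. Qed.

Lemma sgerm_trans t s s' r : sgerm s t r -> sgerm t s' r -> sgerm s s' r.
Proof.
move=> [sr _ d st] [_ s'r d' ts']; split => //; first by rewrite d.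
by apply: filterS2 st ts' => q -> ->.
Qed.

Lemma sgerm_iact s t r : sgerm s t r -> iact A s r = iact A t r.
Proof. by case=> _ _ _ /nbhs_singleton. Qed.

Lemma sgermM s s' t t' r : sgerm s s' (iact A t r) -> sgerm t t' r ->
  sgerm (isgM A s t) (isgM A s' t') r.
Proof.
move=> ss' tt'; have tr := sgerm_iact tt'.
case: ss' tt' => [sr s'r d ss'] [tr1 t'r d' tt'].
have st : idom (isgM A s t) r by apply/idomM.
have s't' : idom (isgM A s' t') r by apply/idomM; rewrite -tr.
split => //; first by rewrite (idegM st) (idegM s't') d d'.
apply: filterS3 (filterI tt' (near_iact ss')) (nbhs_idom st) (nbhs_idom s't').
by move=> q [tq sq] stq s'tq; rewrite !iactM// -tq sq.
Qed.

Lemma sgermV s t r : sgerm s t r -> sgerm (isgV s) (isgV t) (iact A s r).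
Proof.
move=> st; have e := sgerm_iact st; case: st => sr tr d st.
have sVr := idomV sr.
split => //; [by rewrite e; apply: idomV|by rewrite !idegV d|].
(* The local agreement of s and t is transported to the image point by continuity of the inverse of
   s. *)
have := near_iact (s := isgV s) (r := iact A s r); rewrite iactVK// => c.
apply: filterS3 (nbhs_idom sVr) (c _ st) (c _ (nbhs_idom tr)) => q sq.
rewrite iactKV// => qE tq.
by rewrite [q in RHS]qE iactVK.
Qed.

(** An idempotent acts as the identity with degree 0, so s e = t e forces agreement on its domain.
    Conversely, if s and t agree on a cylinder and have equal degree, the projection s_u s_u^* of a
    long enough prefix u of r serves as e. *)
Lemma same_germP s t r r' : idom s r -> idom t r' ->
  same_germ A (s, r) (t, r') <-> r = r' /\ sgerm s t r.
Proof.
move=> sr tr'; rewrite /same_germ /=; split.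
  move=> [rr' [e [ee er se]]]; split => //; rewrite -rr' in tr'.
  have eI q : idom e q -> iact A e q = q.
    move=> eq; have eeq : idom (isgM A e e) q by rewrite ee.
    have := iactM eeq; rewrite ee => /(congr1 (iact A (isgV e))).
    rewrite iactVK// iactVK//.
    by have /idomM[] := eeq.
  have e0 : ideg e = 0.
    have eer : idom (isgM A e e) r by rewrite ee.
    have := idegM eer; rewrite ee => /eqP.
    by rewrite -subr_eq subrr => /eqP <-.
  have ser : idom (isgM A s e) r by apply/idomM; rewrite eI.
  have ter : idom (isgM A t e) r by apply/idomM; rewrite eI.
  split => //.
    have := idegM ser; have := idegM ter; rewrite e0 !addr0 => <- <-.
    by rewrite se.
  apply: filterS2 (nbhs_idom ser) (nbhs_idom er) => q seq eq.
  have := iactM seq; rewrite eI// => <-; rewrite se in seq *.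
  by rewrite iactM// eI.
move=> [<- [_ tr d /nbhs_omegaP[n nst]]] {r' tr'}; split => //.
case: s sr d nst => [[[v g] w]|] //=; case: t tr => [[[v' h] w']|] //=.
move=> [rh _ rhE] [rg _ rgE] d nst.
(* This length puts the cylinder of u inside the set of agreement and makes u extend both w and w',
   so that both products fall under the first case of [isgM]. *)
pose m := maxn n (maxn (size w) (size w')).
pose u := pref m r; pose e : isg G X := Some (u, 1%g, u).
have eM (v1 w1 : seq X) g1 q1 : (size w1 <= m)%N -> ocat w1 q1 = r ->
    exists z, u = w1 ++ z /\
    isgM A (Some (v1, g1, w1)) e = Some (v1 ++ actw A g1 z, restr A g1 z, u).
  move=> w1m w1r.
  have [z uE _] : exists2 z, u = w1 ++ z & q1 = ocat z (odrop m r).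
    by apply: ocat_prefix; rewrite ?size_pref// ocat_pref.
  exists z; split => //.
  by rewrite /e /isgM {1}uE prefix_prefix uE drop_size_cat// mulg1.
have [z [zE sE]] := eM v w g rg (leq_trans (leq_maxl _ _) (leq_maxr _ _)) rgE.
have [z' [z'E tE]] := eM v' w' h rh (leq_trans (leq_maxr _ _) (leq_maxr _ _)) rhE.
(* Equal degrees give equal lengths, without which equal maps would not determine the words over a
   one-letter alphabet. *)
have zz : size (v ++ actw A g z) = size (v' ++ actw A h z').
  have := congr1 size zE; rewrite {1}z'E !size_cat !size_actw => suw.
  by move: d suw; clear; lia.
exists e; split.
- by rewrite /e /= prefix_refl drop_size cats0 mulg1.
- by rewrite -[r in idom _ r](ocat_pref m r); apply: idom_ocat.
- change (isgM A (Some (v, g, w)) e = isgM A (Some (v', h, w')) e).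
  rewrite sE tE; suff [-> ->] : v ++ actw A g z = v' ++ actw A h z' /\
      restr A g z = restr A h z' by [].
  apply: (@ocat_act_inj _ _ A _ _ _ _ zz) => q; have := nst (odrop n (ocat u q)).
  have -> : ocat (pref n r) (odrop n (ocat u q)) = ocat u q.
    rewrite -[RHS](ocat_pref n); congr ocat.
    apply/eq_in_map => i; rewrite mem_iota /= add0n => ilt.
    have im : (i < m)%N by rewrite (leq_trans ilt)// leq_maxl.
    by rewrite /ocat size_pref im nth_mkseq.
  rewrite {1}zE {1}z'E !(ocat_cat _ _ q) !odrop_ocat.
  by rewrite !act_ocat !ocat_cat.
Qed.

Lemma germ_class_refl s r : idom s r -> germ_class A (s, r) (s, r).
Proof.
move=> sr; split => //=; apply/same_germP => //.
by split => //; apply: sgerm_refl.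
Qed.

Lemma germ_eqP s t r r' : idom s r -> idom t r' ->
  germ A s r = germ A t r' <-> r = r' /\ sgerm s t r.
Proof.
move=> sr tr'; rewrite /germ; case: pselect => // ?; case: pselect => // ?; split.
  move=> /(congr1 sval) /= e; apply/same_germP => //.
  have : germ_class A (s, r) (t, r') by rewrite e; apply: germ_class_refl.
  by case.
move=> [rr' st]; apply: eq_exist; rewrite {}rr' in sr st *.
apply/seteqP; split=> -[q1 q2] [/= q12 H]; split=> //=.
  have [rq sq] := (same_germP sr q12).1 H; apply: (same_germP tr' q12).2.
  by split => //; apply: sgerm_trans sq; apply: sgerm_sym.
have [rq sq] := (same_germP tr' q12).1 H; apply: (same_germP sr q12).2.
by split => //; apply: sgerm_trans sq.
Qed.

Lemma grepP (c : germs A) :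
  idom (grep c).1 (grep c).2 /\ c = germ A (grep c).1 (grep c).2.
Proof.
have := svalP (cid (svalP c)); rewrite -/(grep c).
case: (grep c) => s r /= [sr cE]; split => //.
rewrite /germ; case: pselect => // h.
by case: c cE => c cP /= cE; apply: eq_exist.
Qed.

Lemma germ_ind (P : germs A -> Prop) :
  (forall s r, idom s r -> P (germ A s r)) -> forall c, P c.
Proof. by move=> H c; have [sr ->] := grepP c; apply: H. Qed.

Lemma grep_germ s r : idom s r ->
  (grep (germ A s r)).2 = r /\ sgerm (grep (germ A s r)).1 s r.
Proof.
move=> sr; have [h] := grepP (germ A s r).
by move=> /germ_eqP => /(_ sr h)[{4}-> /sgerm_sym ?]; split.
Qed.

Lemma gsrc_germ s r : idom s r -> gsrc (germ A s r) = r.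
Proof. by move=> /grep_germ[]. Qed.

Lemma grng_germ s r : idom s r -> grng (germ A s r) = iact A s r.
Proof. by move=> /grep_germ[rE /sgerm_iact]; rewrite /grng rE. Qed.

Lemma ginv_germ s r : idom s r -> ginv (germ A s r) = germ A (isgV s) (iact A s r).
Proof.
move=> sr; have [rE st] := grep_germ sr; rewrite /ginv grng_germ//.
have := sgermV st; rewrite (sgerm_iact st) => st'.
by apply/germ_eqP => //; case: st'.
Qed.

Lemma gmul_germ s t r : idom t r -> idom s (iact A t r) ->
  gmul (germ A s (iact A t r)) (germ A t r) = germ A (isgM A s t) r.
Proof.
move=> tr sr; have [rE tt'] := grep_germ tr.
have [rE' ss'] := grep_germ sr.
rewrite /gmul gsrc_germ//.
have : sgerm (isgM A (grep (germ A s (iact A t r))).1 (grep (germ A t r)).1)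
         (isgM A s t) r.
  by apply: sgermM => //; rewrite (sgerm_iact tt').
by move=> H; apply/germ_eqP => //; case: H.
Qed.

(** The largest bisection attached to s; its indicator function is the image of s in the convolution
    algebra. *)
Definition slice s : set (germs A) := gslice s (idom s).

Lemma slice_germ s t r : idom t r -> slice s (germ A t r) <-> sgerm s t r.
Proof.
move=> tr; split.
  by move=> [q sq /germ_eqP] => /(_ sq tr)[<-].
by move=> st; have [sr _ _ _] := st; exists r => //; apply/germ_eqP.
Qed.

(** Right cancellation in the groupoid: multiply by the germ of t, respectively of its inverse, and
    use that q t^-1 t and q have the same germ at r. *)
Lemma sgermMV s t q r : idom t r -> idom q r ->
  sgerm s (isgM A q (isgV t)) (iact A t r) <-> sgerm (isgM A s t) q r.
Proof.
move=> tr qr.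
have ttr : sgerm (isgM A (isgM A q (isgV t)) t) q r.
  have d : idom (isgM A q (isgV t)) (iact A t r).
    by apply/idomM; rewrite iactVK//; split => //; apply: idomV.
  have d' : idom (isgM A (isgM A q (isgV t)) t) r by apply/idomM.
  split => //; first by rewrite (idegM d') (idegM d) idegV subrK.
  apply: filterS2 (nbhs_idom d') (nbhs_idom tr) => p dp tp.
  have /idomM[_ dp'] := dp.
  by rewrite iactM// iactM// iactVK.
split.
  by move=> h; apply: sgerm_trans ttr; apply: sgermM h (sgerm_refl tr).
move=> h; have [/idomM[_ sr] _ _ _] := h.
have tV := idomV tr.
have h1 : sgerm (isgM A (isgM A s t) (isgV t)) (isgM A q (isgV t)) (iact A t r).
  by apply: sgermM (sgerm_refl tV); rewrite iactVK.
apply: (sgerm_trans _ h1); apply: sgerm_sym.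
have [d _ _ _] := h1.
have /idomM[_ d1] := d.
split => //; first by rewrite (idegM d) (idegM d1) idegV addrK.
apply: filterS2 (nbhs_idom d) (nbhs_idom tV) => p dp tp.
have /idomM[_ dp'] := dp.
by rewrite iactM// iactM// iactKV.
Qed.

Lemma iact1 r : iact A (isg1 G X) r = r.
Proof. by rewrite -{1}(ocat_nil r) iact_ocat act1 ocat_nil. Qed.

Lemma isgM1 s r : idom s r -> sgerm (isgM A s (isg1 G X)) s r.
Proof.
move=> sr; have d : idom (isgM A s (isg1 G X)) r.
  by apply/idomM; rewrite iact1; split => //; apply: idom1.
split => //; first by rewrite (idegM d) /= subrr addr0.
by apply: filterS (nbhs_idom d) => q dq; rewrite iactM// iact1.
Qed.

Lemma gmul_unit c : gmul c (ginv (gunit A (gsrc c))) = c.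
Proof.
move: c; apply: germ_ind => s r sr; rewrite gsrc_germ// /gunit.
have d1 := @idom1 G X r; rewrite ginv_germ// iact1.
have -> : isgV (isg1 G X) = isg1 G X by rewrite /= invg1.
rewrite -{1}(iact1 r) gmul_germ ?iact1//.
have h := isgM1 sr.
by apply/germ_eqP => //; case: h.
Qed.

End Germs.

(** * The algebra C(G,X) *)

(** The algebra C(G,X) as a type, an element being a congruence class of expressions. It is given
    module and ring structures so that calculations modulo [cgx_eq] become equational. *)
Definition cgq (R : realType) (G : groupType) (X : finType) (A : selfSimilar G X) :=
  {c : set (cgx G X R) | exists p, c = cgx_eq A p}.

HB.instance Definition _ R G X A := gen_eqMixin (@cgq R G X A).
HB.instance Definition _ R G X A := gen_choiceMixin (@cgq R G X A).

Section QuotientAlgebra.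
Variables (R : realType) (G : groupType) (X : finType) (A : selfSimilar G X).
Local Notation C := (R[i]).
Local Notation cgx := (cgx G X R).
Local Notation Q := (cgq R A).
Implicit Types (p q : cgx) (a b c : Q).

Definition cls p : Q := exist _ (cgx_eq A p) (ex_intro _ p erefl).

Definition rep c : cgx := sval (cid (svalP c)).

Lemma cls_eq p q : cls p = cls q <-> cgx_eq A p q.
Proof.
split=> [/(congr1 sval) /= ->|pq]; first exact: cgx_refl.
apply: eq_exist; apply/seteqP; split=> t; apply: cgx_trans => //.
exact: cgx_sym.
Qed.

Lemma repK c : cls (rep c) = c.
Proof.
rewrite /rep; case: cid => p /= pE; case: c pE => c cP /= cE.
exact: eq_exist.
Qed.

Lemma rep_cls p : cgx_eq A (rep (cls p)) p.
Proof. by apply/cls_eq; rewrite repK. Qed.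

Lemma cls_ind (P : Q -> Prop) : (forall p, P (cls p)) -> forall c, P c.
Proof. by move=> H c; rewrite -(repK c). Qed.

Definition cgq_add a b := cls (CAdd (rep a) (rep b)).
Definition cgq_opp a := cls (CScale (-1) (rep a)).
Definition cgq_scale (k : C) a := cls (CScale k (rep a)).
Definition cgq_mul a b := cls (CMul (rep a) (rep b)).
Definition cgq_star a := cls (CStar (rep a)).

Lemma cgq_addE p q : cgq_add (cls p) (cls q) = cls (CAdd p q).
Proof. by apply/cls_eq/cgx_congrD; apply: rep_cls. Qed.

Lemma cgq_scaleE k p : cgq_scale k (cls p) = cls (CScale k p).
Proof. by apply/cls_eq/cgx_congrZ; apply: rep_cls. Qed.

Lemma cgq_mulE p q : cgq_mul (cls p) (cls q) = cls (CMul p q).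
Proof. by apply/cls_eq/cgx_congrM; apply: rep_cls. Qed.

Lemma cgq_starE p : cgq_star (cls p) = cls (CStar p).
Proof. by apply/cls_eq/cgx_congrV; apply: rep_cls. Qed.

Lemma cgq_addA : associative cgq_add.
Proof.
elim/cls_ind => p; elim/cls_ind => q; elim/cls_ind => r; rewrite !cgq_addE.
exact/cls_eq/cgx_addA.
Qed.

Lemma cgq_addC : commutative cgq_add.
Proof.
by elim/cls_ind => p; elim/cls_ind => q; rewrite !cgq_addE; apply/cls_eq/cgx_addC.
Qed.

Lemma cgq_add0 : left_id (cls (C0 G X R)) cgq_add.
Proof. by elim/cls_ind => p; rewrite cgq_addE; apply/cls_eq/cgx_add0. Qed.

Lemma cgq_addN : left_inverse (cls (C0 G X R)) cgq_opp cgq_add.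
Proof.
elim/cls_ind => p; rewrite -[cgq_opp _]/(cgq_scale (-1) _) cgq_scaleE cgq_addE.
apply/cls_eq; apply: (cgx_trans (q := CScale (-1 + 1) p)).
  apply: cgx_sym; apply: cgx_trans (cgx_scaleDl _ _ _ _) _.
  by apply: cgx_congrD; [exact: cgx_refl|exact: cgx_scale1].
by rewrite addNr; apply: cgx_scale0.
Qed.

HB.instance Definition _ := GRing.isZmodule.Build Q
  cgq_addA cgq_addC cgq_add0 cgq_addN.

Lemma cgq_mulA : associative cgq_mul.
Proof.
elim/cls_ind => p; elim/cls_ind => q; elim/cls_ind => r; rewrite !cgq_mulE.
exact/cls_eq/cgx_mulA.
Qed.

Lemma cgq_mul1l : left_id (cls (C1 G X R)) cgq_mul.
Proof. by elim/cls_ind => p; rewrite cgq_mulE; apply/cls_eq/cgx_mul1l. Qed.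

Lemma cgq_mul1r : right_id (cls (C1 G X R)) cgq_mul.
Proof. by elim/cls_ind => p; rewrite cgq_mulE; apply/cls_eq/cgx_mul1r. Qed.

Lemma cgq_mulDl : left_distributive cgq_mul +%R.
Proof.
elim/cls_ind => p; elim/cls_ind => q; elim/cls_ind => r.
change (cgq_mul (cgq_add (cls p) (cls q)) (cls r) =
  cgq_add (cgq_mul (cls p) (cls r)) (cgq_mul (cls q) (cls r))).
rewrite !(cgq_addE, cgq_mulE).
exact/cls_eq/cgx_mulDl.
Qed.

Lemma cgq_mulDr : right_distributive cgq_mul +%R.
Proof.
elim/cls_ind => p; elim/cls_ind => q; elim/cls_ind => r.
change (cgq_mul (cls p) (cgq_add (cls q) (cls r)) =
  cgq_add (cgq_mul (cls p) (cls q)) (cgq_mul (cls p) (cls r))).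
rewrite !(cgq_addE, cgq_mulE).
exact/cls_eq/cgx_mulDr.
Qed.

HB.instance Definition _ := GRing.Zmodule_isPzRing.Build Q
  cgq_mulA cgq_mul1l cgq_mul1r cgq_mulDl cgq_mulDr.

Lemma cgq_scaleA k l a : cgq_scale k (cgq_scale l a) = cgq_scale (k * l) a.
Proof. by elim/cls_ind: a => p; rewrite !cgq_scaleE; apply/cls_eq/cgx_scaleA. Qed.

Lemma cgq_scale1 : left_id 1 cgq_scale.
Proof. by elim/cls_ind => p; rewrite !cgq_scaleE; apply/cls_eq/cgx_scale1. Qed.

Lemma cgq_scaleDr : right_distributive cgq_scale +%R.
Proof.
move=> k; elim/cls_ind => p; elim/cls_ind => q.
change (cgq_scale k (cgq_add (cls p) (cls q)) =
  cgq_add (cgq_scale k (cls p)) (cgq_scale k (cls q))).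
rewrite !(cgq_addE, cgq_scaleE).
exact/cls_eq/cgx_scaleDr.
Qed.

Lemma cgq_scaleDl a : {morph cgq_scale^~ a : k l / k + l}.
Proof.
move=> k l; elim/cls_ind: a => p.
change (cgq_scale (k + l) (cls p) =
  cgq_add (cgq_scale k (cls p)) (cgq_scale l (cls p))).
rewrite !(cgq_addE, cgq_scaleE).
exact/cls_eq/cgx_scaleDl.
Qed.

HB.instance Definition _ := GRing.Zmodule_isLmodule.Build C Q
  cgq_scaleA cgq_scale1 cgq_scaleDr cgq_scaleDl.

Lemma cls0 : cls (C0 G X R) = 0. Proof. by []. Qed.
Lemma clsD p q : cls (CAdd p q) = cls p + cls q.
Proof. by rewrite -cgq_addE. Qed.
Lemma clsM p q : cls (CMul p q) = cls p * cls q.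
Proof. by rewrite -cgq_mulE. Qed.
Lemma clsZ k p : cls (CScale k p) = k *: cls p.
Proof. by rewrite -cgq_scaleE. Qed.

Lemma cgq_scaleAl k a b : (k *: a) * b = k *: (a * b).
Proof.
elim/cls_ind: a => p; elim/cls_ind: b => q; rewrite -clsZ -!clsM -clsZ.
exact/cls_eq/cgx_scaleAl.
Qed.

Lemma cgq_scaleAr k a b : a * (k *: b) = k *: (a * b).
Proof.
elim/cls_ind: a => p; elim/cls_ind: b => q; rewrite -clsZ -!clsM -clsZ.
exact/cls_eq/cgx_scaleAr.
Qed.

Lemma cgq_starK : involutive cgq_star.
Proof. by elim/cls_ind => p; rewrite !cgq_starE; apply/cls_eq/cgx_starK. Qed.

Lemma cgq_starD a b : cgq_star (a + b) = cgq_star a + cgq_star b.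
Proof.
elim/cls_ind: a => p; elim/cls_ind: b => q; rewrite -clsD !cgq_starE -clsD.
exact/cls_eq/cgx_starD.
Qed.

Lemma cgq_starZ k a : cgq_star (k *: a) = (k^*)%C *: cgq_star a.
Proof.
elim/cls_ind: a => p; rewrite -clsZ !cgq_starE -clsZ.
exact/cls_eq/cgx_starZ.
Qed.

Lemma cgq_starM a b : cgq_star (a * b) = cgq_star b * cgq_star a.
Proof.
elim/cls_ind: a => p; elim/cls_ind: b => q; rewrite -clsM !cgq_starE -clsM.
exact/cls_eq/cgx_starM.
Qed.

Lemma cgq_star0 : cgq_star 0 = 0.
Proof. by apply: (addrI (cgq_star 0)); rewrite -cgq_starD !addr0. Qed.

Lemma cgq_star1 : cgq_star 1 = 1.
Proof. by rewrite -[LHS]mulr1 -{2}(cgq_starK 1) -cgq_starM mulr1 cgq_starK. Qed.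

Definition cgqU (g : G) : Q := cls (CU X R g).
Definition cgqS (w : seq X) : Q := \prod_(x <- w) cls (CS G R x).

Lemma cgqU1 : cgqU 1%g = 1.
Proof. exact/cls_eq/cgx_u1. Qed.

Lemma cgqUM g h : cgqU (g * h)%g = cgqU g * cgqU h.
Proof. by rewrite -clsM; apply/cls_eq/cgx_uM. Qed.

Lemma cgqUV g : cgq_star (cgqU g) = cgqU g^-1%g.
Proof.
rewrite -[LHS]mulr1 -cgqU1 -(mulgV g) cgqUM mulrA.
suff -> : cgq_star (cgqU g) * cgqU g = 1 by rewrite mul1r.
by rewrite /cgqU cgq_starE -clsM; apply/cls_eq/cgx_uVl.
Qed.

Lemma cgqS_nil : cgqS [::] = 1.
Proof. by rewrite /cgqS big_nil. Qed.

Lemma cgqS_cat v w : cgqS (v ++ w) = cgqS v * cgqS w.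
Proof. by rewrite /cgqS big_cat. Qed.

Lemma cgqS1 x : cgqS [:: x] = cls (CS G R x).
Proof. by rewrite /cgqS big_seq1. Qed.

Lemma cgqS_cons x w : cgqS (x :: w) = cgqS [:: x] * cgqS w.
Proof. by rewrite -cgqS_cat. Qed.

Lemma cgqUS g w : cgqU g * cgqS w = cgqS (actw A g w) * cgqU (restr A g w).
Proof.
elim: w g => [|x w IH] g; first by rewrite /= cgqS_nil mulr1 mul1r.
rewrite cgqS_cons mulrA -(cat1s x w) actw_cat cgqS_cat restr_cat.
rewrite -[RHS]mulrA -IH mulrA.
congr (_ * _).
have [y yE] : exists y, actw A g [:: x] = [:: y].
  by have := size_actw A g [:: x]; case: actw => [|y [|]] // _; exists y.
rewrite yE !cgqS1 -!clsM; apply/cls_eq.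
by have := cgx_us A R g x; rewrite yE.
Qed.

Lemma cgqSVS w : cgq_star (cgqS w) * cgqS w = 1.
Proof.
elim: w => [|x w IH]; first by rewrite cgqS_nil mulr1 cgq_star1.
rewrite cgqS_cons cgq_starM -mulrA (mulrA _ (cgqS [:: x])).
suff -> : cgq_star (cgqS [:: x]) * cgqS [:: x] = 1 by rewrite mul1r.
by rewrite cgqS1 cgq_starE -clsM; apply/cls_eq/cgx_CK1.
Qed.

(** Common initial letters cancel by the first part of (CK1); the first differing pair of letters
    then annihilates the product. *)
Lemma cgqSVS0 v w : ~~ prefix v w -> ~~ prefix w v ->
  cgq_star (cgqS v) * cgqS w = 0.
Proof.
elim: v w => [|x v IH] [|y w] //=.
rewrite cgqS_cons (cgqS_cons y) cgq_starM -mulrA (mulrA _ (cgqS [:: y])) [y == x]eq_sym.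
have [<-|xy] := eqVneq x y => /= vw wv.
  have := cgqSVS [:: x] => ->; rewrite mul1r; exact: IH.
suff -> : cgq_star (cgqS [:: x]) * cgqS [:: y] = 0 by rewrite mul0r mulr0.
by rewrite !cgqS1 cgq_starE -clsM; apply/cls_eq/cgx_CK1'/eqP.
Qed.

(** Iterating (CK2) gives a as the sum of a s_w s_w^* over all words w of length n. *)
Lemma cgq_eq0 n a : (forall w, size w = n -> a * cgqS w = 0) -> a = 0.
Proof.
elim: n a => [|n IH] a H; first by have := H [::] erefl; rewrite cgqS_nil mulr1.
apply: IH => w wn; rewrite -[LHS]mulr1.
have -> : 1 = \sum_(x : X) cgqS [:: x] * cgq_star (cgqS [:: x]) :> Q.
  have <- : cls _ = 1 := (cls_eq _ _).2 (cgx_CK2 A R).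
  rewrite (big_morph cls clsD cls0) big_enum /=; apply: eq_bigr => x _.
  by rewrite clsM -cgq_starE cgqS1.
rewrite mulr_sumr big1// => x _.
by rewrite mulrA -(mulrA a) -cgqS_cat cats1 H ?mul0r// size_rcons wn.
Qed.

Definition mon (s : isg G X) : Q :=
  if s is Some (v, g, w) then cgqS v * cgqU g * cgq_star (cgqS w) else 0.

(** With [monV], this makes the span of the monomials a subalgebra closed under the star, hence all
    of C(G,X). *)
Lemma monM s t : mon s * mon t = mon (isgM A s t).
Proof.
case: s => [[[v g] w]|]; last by rewrite mul0r.
case: t => [[[v' h] t]|]; last by rewrite mulr0.
rewrite /isgM; case: ifPn => [/prefixP[z ->]|wv'].
  rewrite drop_size_cat//= !cgqS_cat cgqUM.
  rewrite -!mulrA (mulrA (cgq_star _)) cgqSVS mul1r.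
  by rewrite 3!mulrA -(mulrA (cgqS v)) cgqUS !mulrA.
case: ifPn => [/prefixP[z ->]|v'w] /=; last first.
  by rewrite -!mulrA (mulrA (cgq_star _)) cgqSVS0// !(mul0r, mulr0).
rewrite drop_size_cat// !cgqS_cat !cgq_starM cgqUM -!mulrA.
rewrite (mulrA (cgq_star (cgqS v'))) cgqSVS mul1r.
do 2!congr (_ * _); rewrite !mulrA; congr (_ * _).
by rewrite -cgqUV -!cgq_starM -cgqUS cgq_starM cgqUV invgK.
Qed.

Lemma monV s : cgq_star (mon s) = mon (isgV s).
Proof.
case: s => [[[v g] w]|] /=; last exact: cgq_star0.
by rewrite !cgq_starM cgq_starK cgqUV mulrA.
Qed.

End QuotientAlgebra.

(** * Convolution and the essential ideal *)

Section ConvolutionAlgebra.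
Variables (R : realType) (G : groupType) (X : finType) (A : selfSimilar G X).
Local Notation C := (R[i]).
Implicit Types (l : seq (C * isg G X)) (s t : isg G X) (r : omega X) (c d : germs A).

Definition slsum l : germs A -> C := fun c => \sum_(q <- l) q.1 * \1_(slice q.2) c.

Lemma indic_iff (T U : Type) (B : set T) (D : set U) x y :
  (B x <-> D y) -> \1_B x = \1_D y :> C.
Proof.
move=> BD; rewrite !indicE; congr ((nat_of_bool _)%:R).
by apply/idP/idP; rewrite !inE => /BD.
Qed.

Lemma slice_gsrc t c : slice t c -> idom t (gsrc c) /\ c = germ A t (gsrc c).
Proof. by move=> [r tr <-]; rewrite gsrc_germ. Qed.

(** The pointwise form of the rule that indicator functions of slices convolve to that of the
    product slice. *)
Lemma slice_mul s t c : idom t (gsrc c) ->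
  slice s (gmul c (ginv (germ A t (gsrc c)))) <-> slice (isgM A s t) c.
Proof.
elim/germ_ind: c => q r qr; rewrite gsrc_germ// => tr.
rewrite ginv_germ//.
have tV := idomV A tr.
have e : iact A (isgV t) (iact A t r) = r by rewrite iactVK.
rewrite -{1}e gmul_germ ?e//.
have d : idom (isgM A q (isgV t)) (iact A t r) by apply/idomM; rewrite e.
rewrite slice_germ// slice_germ//.
exact: sgermMV.
Qed.

Lemma slice_inv s c : slice s (ginv c) <-> slice (isgV s) c.
Proof.
elim/germ_ind: c => q r qr.
rewrite ginv_germ// slice_germ ?slice_germ//; last exact: idomV.
have e := iactVK A qr.
split=> h; have h' := sgermV h.
  by move: h'; rewrite (sgerm_iact h) e isgVK.
by rewrite -(sgerm_iact h); rewrite isgVK in h'.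
Qed.

Lemma conv_slsum (a : germs A -> C) l c : conv a (slsum l) c =
  \sum_(q <- l) q.1 * (a (gmul c (ginv (germ A q.2 (gsrc c)))) *+
    `[< idom q.2 (gsrc c) >]).
Proof.
rewrite /conv /lreg; set r := gsrc c.
(* In the fiber over r the function [slsum l] is supported on these finitely many germs. Distinct
   terms may share a germ, hence the removal of duplicates. *)
pose D := undup [seq germ A q.2 r | q <- l & `[< idom q.2 r >]].
have inD d : d \in D -> gsrc d = r.
  rewrite mem_undup => /mapP[q]; rewrite mem_filter => /andP[/asboolP qr _] ->.
  by rewrite gsrc_germ.
rewrite (fsbigE D) ?undup_uniq//; last first.
  move=> d dr dD; rewrite /slsum big_seq big1 ?mulr0// => q ql.
  rewrite indicE memNset ?mulr0// => /slice_gsrc; rewrite dr => -[qr dE].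
  move/negP: dD; apply; rewrite mem_undup; apply/mapP; exists q => //.
  by rewrite mem_filter ql andbT; apply/asboolP.
rewrite big_seq_cond (eq_bigl (fun d => d \in D)); last first.
  by move=> d; case: (boolP (d \in D)) => //= dD; apply: mem_set; apply: inD.
rewrite -big_seq /slsum.
under eq_bigr do rewrite mulr_sumr.
rewrite exchange_big /= [LHS]big_seq [RHS]big_seq; apply: eq_bigr => q ql.
under eq_bigr do rewrite mulrCA.
rewrite -mulr_sumr; congr (_ * _); case: asboolP => qr.
  have gD : germ A q.2 r \in D.
    rewrite mem_undup; apply/mapP; exists q => //.
    by rewrite mem_filter ql andbT; apply/asboolP.
  rewrite (bigD1_seq _ gD) ?undup_uniq//= indicE mem_set ?mulr1; last by exists r.
  rewrite [X in _ + X]big_seq_cond big1 ?addr0// => d /andP[/inD dr dg].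
  rewrite indicE memNset ?mulr0// => /slice_gsrc[_]; rewrite dr => dE.
  by move: dg; rewrite dE eqxx.
rewrite big_seq big1// => d /inD dr.
by rewrite indicE memNset ?mulr0// => /slice_gsrc[]; rewrite dr.
Qed.

Lemma conv_slsum2 l l' : conv (slsum l) (slsum l') =
  slsum [seq (p.1 * q.1, isgM A p.2 q.2) | p <- l, q <- l'].
Proof.
apply/funext => c; rewrite conv_slsum /slsum big_allpairs_dep exchange_big /=.
apply: eq_bigr => -[k t] _ /=; case: asboolP => tr.
  rewrite mulr1n mulr_sumr; apply: eq_bigr => -[j s] _ /=.
  rewrite mulrA [k * j]mulrC; congr (_ * _).
  exact/indic_iff/slice_mul.
rewrite mulr0n mulr0 big1// => -[j s] _ /=.
by rewrite indicE memNset ?mulr0// => /slice_gsrc[/idomM[]].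
Qed.

Lemma gstar_slsum l : gstar (slsum l) =
  slsum [seq ((q.1)^*%C, isgV q.2) | q <- l].
Proof.
apply/funext => c; rewrite /gstar /slsum big_map.
rewrite (raddf_sum (@conjc R)); apply: eq_bigr => -[k s] _ /=.
rewrite (rmorphM (@conjc R)) /=; congr (_ * _).
rewrite {1}indicE conjc_nat -indicE; exact/indic_iff/slice_inv.
Qed.

Lemma idom_nil v (g : G) : idom (Some (v, g, [::])) = [set: omega X].
Proof. by apply/seteqP; split=> // r _; exists r => //; rewrite ocat_nil. Qed.

(** A single list describes p both in C(G,X), where nonvanishing is tracked, and as a function on
    germs, where membership in the essential ideal is tracked. *)
Lemma cgx_normal_form (p : cgx G X R) : exists l,
  cls A p = \sum_(q <- l) q.1 *: mon R A q.2 /\ cgx_fun p = slsum l.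
Proof.
have single s f e : cls A e = mon R A s -> f = \1_(slice s) ->
    exists l, cls A e = \sum_(q <- l) q.1 *: mon R A q.2 /\ f = slsum l.
  move=> eE fE; exists [:: (1, s)]; rewrite big_seq1 scale1r; split => //.
  by apply/funext => c; rewrite /slsum big_seq1 mul1r fE.
elim: p => [g|x|||p [l [lp lf]] q [l' [l'q l'f]]|k p [l [lp lf]]
    |p [l [lp lf]] q [l' [l'q l'f]]|p [l [lp lf]]].
- apply: (single (isgu X g)); first by rewrite /= cgqS_nil cgq_star1 mul1r mulr1.
  by rewrite /slice idom_nil.
- apply: (single (isgs G x)); first by rewrite /= cgqS_nil cgq_star1 cgqU1 cgqS1 !mulr1.
  by rewrite /slice idom_nil.
- exists [::]; rewrite big_nil; split => //.
  by apply/funext => c; rewrite /slsum big_nil.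
- apply: (single (isg1 G X)); first by rewrite /= cgqS_nil cgq_star1 cgqU1 !mulr1.
  by rewrite /slice idom_nil.
- exists (l ++ l'); rewrite clsD lp l'q big_cat; split => //=.
  by apply/funext => c; rewrite lf l'f /slsum big_cat.
- exists [seq (k * q.1, q.2) | q <- l]; rewrite clsZ lp big_map scaler_sumr.
  split; first by apply: eq_bigr => q _; rewrite scalerA.
  apply/funext => c; rewrite /= lf /slsum big_map mulr_sumr.
  by apply: eq_bigr => q _; rewrite mulrA.
- exists [seq (p.1 * q.1, isgM A p.2 q.2) | p <- l, q <- l'].
  split; last by rewrite /= lf l'f conv_slsum2.
  rewrite clsM lp l'q big_allpairs_dep mulr_suml; apply: eq_bigr => i _.
  rewrite mulr_sumr; apply: eq_bigr => j _ /=.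
  by rewrite cgq_scaleAl cgq_scaleAr monM scalerA.
- exists [seq ((q.1)^*%C, isgV q.2) | q <- l].
  split; last by rewrite /= lf gstar_slsum.
  rewrite -cgq_starE lp big_map.
  rewrite (big_morph _ (@cgq_starD _ _ _ A) (@cgq_star0 _ _ _ A)).
  by apply: eq_bigr => q _; rewrite cgq_starZ monV.
Qed.

(** Applied to the point mass at a unit, the regular representation keeps a single summand. Hence
    [Iess_alg] is a condition on the strict support of the function itself. *)
Lemma opfun_lreg (a : germs A -> C) : opfun (lreg a) = a.
Proof.
apply/funext => c; rewrite /opfun /lreg.
have gu r : gsrc (gunit A r) = r by rewrite gsrc_germ//; apply: idom1.
rewrite (fsbigE [:: gunit A (gsrc c)])//=; last 2 first.
- by move=> d /=; rewrite inE => /eqP ->; apply: gu.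
- move=> d _; rewrite inE => dc; rewrite indicE memNset ?mulr0//= => dE.
  by rewrite dE eqxx in dc.
rewrite big_cons big_nil ifT; last by rewrite inE; apply: gu.
by rewrite addr0 gmul_unit indicE mem_set ?mulr1.
Qed.

Lemma near_sgerm s t r : sgerm A s t r -> \forall q \near r, sgerm A s t q.
Proof.
case=> sr tr d /near_join st.
by apply: filterS3 (nbhs_idom sr) (nbhs_idom tr) st => q sq tq ?; split.
Qed.

(** Continuity of the section r |-> [s, r]: if [s, r] lies in the slice of t, then s and t agree
    near r, so the neighbouring germs of s lie there too. *)
Lemma near_germ s r (O : set (germs A)) : idom s r -> nbhs (germ A s r) O ->
  \forall q \near r, O (germ A s q).
Proof.
(* The topology is given by a subbase, so O contains a finite intersection F of basic sets around
   the germ, and each of them is treated separately. *)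
move=> sr [B [[D' D'D <-] [F D'F Fc] BO]]; have [K KD KF] := D'D _ D'F.
have : \forall q \near r, F (germ A s q); last first.
  by apply: filterS => q Fq; apply: BO; exists F.
rewrite -KF.
apply: (@filterS _ (nbhs r) _ (\bigcap_(V in [set` K]) (germ A s @^-1` V))) => //.
apply: filter_bigI => V VK.
have Vr : V (germ A s r) by move: Fc; rewrite -KF => /(_ V VK).
have /set_mem[t [U [oU Ut VE]]] := KD _ VK.
move: Vr; rewrite VE => -[r' Ur' e].
have [rr' ts] := (germ_eqP A (Ut _ Ur') sr).1 e; rewrite rr' in Ur' ts.
have nU : nbhs r U by exact: open_nbhs_nbhs.
apply: filterS2 nU (near_sgerm ts) => q Uq tq.
exists q => //; have [tq' sq _ _] := tq; exact/germ_eqP.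
Qed.

Lemma open_gslice s (U : set (omega X)) : open U -> U `<=` idom s ->
  open (gslice s U : set (germs A)).
Proof.
move=> oU Us; exists [set gslice s U]; last by rewrite bigcup_set1.
move=> _ ->; apply: (@finI_from1 _ _ _ id).
by exists s, U.
Qed.

(** Empty interior of the strict support, tested on the basic open sets of germs. *)
Definition ess l := forall t (U : set (omega X)), open U -> U !=set0 -> U `<=` idom t ->
  exists2 r, U r & slsum l (germ A t r) = 0.

Lemma ess_interior l : ess l <-> interior [set c | slsum l c != 0] = set0.
Proof.
split=> [el|il].
  rewrite -subset0 => c; elim/germ_ind: c => t r tr ic.
  have nO := near_germ tr ic.
  have [|||q] := el t (interior (fun q => slsum l (germ A t q) != 0 /\ idom t q)).
  - exact: open_interior.
  - exists r; exact: (filterI nO (nbhs_idom tr)).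
  - by move=> q /interior_subset[].
  - by move=> /interior_subset[/eqP].
move=> t U oU [r Ur] Ut; apply: contrapT => nU.
suff : interior [set c | slsum l c != 0] (germ A t r) by rewrite il.
exists (gslice t U); split.
- exact: open_gslice.
- by exists r.
- move=> _ [q Uq <-] /=; apply/eqP => q0; apply: nU.
  by exists q.
Qed.

Lemma Iess_algP (p : cgx G X R) l : cgx_fun p = slsum l -> Iess_alg A p -> ess l.
Proof.
move=> pl [_]; rewrite opfun_lreg pl => h; exact/ess_interior.
Qed.

Lemma redCstar_lreg (a : germs A -> C) : convalg a -> redCstar (lreg a).
Proof.
move=> ca e e0; exists a => //; apply: ub_ereal_sup => _ [r [f [_ _ ->]]].
rewrite /l2norm esum1; first by rewrite sqrte0 lee_fin ltW.
by move=> c _; rewrite subrr normr0 /= expr0n.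
Qed.

Lemma compact_slice_isgu (g : G) : compact (slice (isgu X g) : set (germs A)).
Proof.
rewrite /slice idom_nil /gslice; apply: continuous_compact; last exact: compact_omega.
apply: continuous_subspaceT => r O; apply: near_germ.
by rewrite idom_nil.
Qed.

Lemma bisection_slice_isgu (g : G) : bisection (slice (isgu X g) : set (germs A)).
Proof.
split=> c d /set_mem[r rs <-] /set_mem[q qs <-].
  by rewrite !gsrc_germ// => ->.
rewrite !grng_germ// => e; congr germ.
by rewrite -(iactVK A rs) e iactVK.
Qed.

Lemma convalg_isgu (L : seq (C * G)) :
  convalg (slsum [seq (q.1, isgu X q.2) | q <- L]).
Proof.
exists (size L), (fun i => (tnth (in_tuple L) i).1),
  (fun i => slice (isgu X (tnth (in_tuple L) i).2)); split.
  move=> i; split; [exact: compact_slice_isgu| |exact: bisection_slice_isgu].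
  by apply: open_gslice => //; rewrite idom_nil; exact: openT.
by apply/funext => c; rewrite /slsum big_map big_tnth.
Qed.

Lemma ess_Iess_alg (p : cgx G X R) (L : seq (C * G)) :
  cgx_fun p = slsum [seq (q.1, isgu X q.2) | q <- L] ->
  ess [seq (q.1, isgu X q.2) | q <- L] -> Iess_alg A p.
Proof.
move=> pl /ess_interior h; split; first by rewrite pl; apply/redCstar_lreg/convalg_isgu.
by rewrite opfun_lreg pl.
Qed.

Lemma cgx_fun_grpalg (a : grpalg G R) :
  cgx_fun (grpalg_cgx X a) = slsum [seq (a g, isgu X g) | g <- finsupp a].
Proof.
apply/funext => c; rewrite /grpalg_cgx /slsum big_map.
rewrite (big_morph (fun p => cgx_fun p c) (op1 := +%R) (id1 := 0))//=.
by apply: eq_bigr => g _ /=; rewrite /slice idom_nil.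
Qed.

End ConvolutionAlgebra.

(** * Restriction to cylinders *)

Section Compression.
Variables (R : realType) (G : groupType) (X : finType) (A : selfSimilar G X).
Local Notation C := (R[i]).
Implicit Types (l : seq (C * isg G X)) (L : seq (C * G)) (v w : seq X)
  (s t : isg G X) (r : omega X).

(* If s is [s_v' u_g s_w'^*] with [|w'| <= |w|], then [s s_w] is 0 unless
   [cuts w s], and then it is [s_v u_h] for [v = cut_word w s] and
   [h = cut_elt w s].  Hence [compress v w l] is the [s_v CG]-component of
   [l s_w], divided by [s_v]. *)
Definition cut_word w s : seq X :=
  if s is Some (v', g, w') then v' ++ actw A g (drop (size w') w) else [::].

Definition cut_elt w s : G :=
  if s is Some (_, g, w') then restr A g (drop (size w') w) else 1%g.

Definition cuts w s : bool :=
  if s is Some (_, _, w') then prefix w' w else false.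

(** The bound under which multiplying on the right by s_w with |w| = n absorbs the adjoint factor of
    s completely. *)
Definition level n s : bool :=
  if s is Some (_, _, w') then (size w' <= n)%N else true.

Definition compress v w l : seq (C * G) :=
  [seq (q.1, cut_elt w q.2) | q <- l & cuts w q.2 && (cut_word w q.2 == v)].

Definition emb L : seq (C * isg G X) := [seq (q.1, isgu X q.2) | q <- L].

Lemma idom_isgu (g : G) r : idom (isgu X g) r.
Proof. by rewrite idom_nil. Qed.

Lemma iact_isgu (g : G) r : iact A (isgu X g) r = act A g r.
Proof. by rewrite -[in LHS](ocat_nil r) iact_ocat ocat_nil. Qed.

Lemma near_ocat w r (P : omega X -> Prop) :
  (\forall q \near ocat w r, P q) <-> \forall q \near r, P (ocat w q).
Proof.
split; first exact: continuous_ocat.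
move=> h.
have h' : \forall q \near ocat w r, P (ocat w (odrop (size w) q)).
  apply: (@continuous_odrop _ (size w) (ocat w r) (fun q => P (ocat w q))).
  by rewrite /= odrop_ocat.
apply: filterS2 h' (nbhs_ocat w r) => q + [q' _ qE].
by rewrite -qE odrop_ocat.
Qed.

(** Under the open embedding sending the germ of u_h at r to that of s_v u_h s_w^* at w r, the slice
    of s pulls back to the slice of its cut element, or to the empty set. *)
Lemma cut_sgerm v w h s r : level (size w) s ->
  sgerm A s (Some (v, h, w)) (ocat w r) <->
  (cuts w s && (cut_word w s == v)) /\ sgerm A (isgu X (cut_elt w s)) (isgu X h) r.
Proof.
case: s => [[[v' g] w']|] /= ww'; last by split; [case|case].
split.
- move=> [[r' _ e] _ /= d st].
  have [z wE r'E] := ocat_prefix ww' e; subst w r'.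
  rewrite prefix_prefix drop_size_cat//=.
  have st' : \forall q \near r, ocat (v' ++ actw A g z) (act A (restr A g z) q) =
      ocat v (act A h q).
    move/near_ocat: st; apply: filterS => q.
    by rewrite /= odrop_ocat ocat_cat odrop_ocat act_ocat -ocat_cat.
  (* Equality of degrees allows the prefixes of the common image to be compared. *)
  have vE : size (v' ++ actw A g z) = size v.
    by move: d; rewrite !size_cat size_actw; lia.
  have [e1 _] := ocat_inj vE (nbhs_singleton st'); rewrite e1 eqxx.
  split => //; split => //; try exact: idom_isgu.
  apply: filterS st' => q; rewrite !iact_isgu e1 => e2.
  by have [] := ocat_inj erefl e2.
- move=> [/andP[/prefixP[z wE] /eqP vE] [_ _ _ st]]; subst w.
  rewrite drop_size_cat// in vE st *.
  split; [by rewrite ocat_cat; apply: idom_ocat|exact: idom_ocat| |].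
    by rewrite -vE /= !size_cat size_actw; lia.
  apply/near_ocat; apply: filterS st => q; rewrite !iact_isgu => e.
  by rewrite ocat_cat iact_ocat act_ocat -ocat_cat vE e -ocat_cat iact_ocat.
Qed.

Lemma compress_slsum v w h l r : all (fun q => level (size w) q.2) l ->
  slsum (emb (compress v w l)) (germ A (isgu X h) r) =
  slsum l (germ A (Some (v, h, w)) (ocat w r)).
Proof.
move=> /allP ll; rewrite /slsum /emb /compress big_map big_map big_filter big_mkcond /=.
rewrite big_seq [RHS]big_seq; apply: eq_bigr => -[k s] /ll /= sw.
have H := cut_sgerm v h r sw.
case: ifPn => c.
  congr (_ * _); apply: indic_iff; rewrite !slice_germ; last 2 first.
  - exact: idom_ocat.
  - exact: idom_isgu.
  by rewrite H c; split => // -[].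
rewrite indicE memNset ?mulr0//.
by rewrite slice_germ; [move=> /H[+ _]; apply/negP|exact: idom_ocat].
Qed.

Lemma compress_ess v w l : all (fun q => level (size w) q.2) l ->
  ess A l -> ess A (emb (compress v w l)).
Proof.
move=> ll el t U oU [r Ur] Ut.
have [z|/eqP] := eqVneq (slsum (emb (compress v w l)) (germ A t r)) 0.
  by exists r.
(* A nonzero value forces the germ of t at r to be that of some u_g, so it lies in the domain of the
   embedding; U is then carried into the slice of s_v u_g s_w^*. *)
move=> nz; have [g gr] : exists g, sgerm A (isgu X g) t r.
  apply: contrapT => ng; apply: nz; rewrite /slsum /emb big_map big1// => -[k g] _ /=.
  rewrite indicE memNset ?mulr0// slice_germ; last exact: Ut.
  by move=> gt; apply: ng; exists g.
have nU : nbhs r U by exact: open_nbhs_nbhs.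
pose V := ocat w @` (U `&` [set q | sgerm A (isgu X g) t q]).
have nV : nbhs (ocat w r) V.
  apply/near_ocat; apply: filterS2 nU (near_sgerm gr) => q Uq gq.
  by exists q.
have [|||_ /interior_subset[q [Uq gq] <-]] := el (Some (v, g, w)) (interior V).
- exact: open_interior.
- by exists (ocat w r).
- by move=> _ /interior_subset[q _ <-]; apply: idom_ocat.
rewrite -compress_slsum// => q0; exists q => //.
suff -> : germ A t q = germ A (isgu X g) q by [].
have [gq' tq _ _] := gq.
by apply/germ_eqP => //; split => //; apply: sgerm_sym.
Qed.

Definition qsum l : cgq R A := \sum_(q <- l) q.1 *: mon R A q.2.
Definition gsum L : cgq R A := \sum_(q <- L) q.1 *: cgqU R A q.2.

Lemma qsum_emb L : qsum (emb L) = gsum L.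
Proof.
rewrite /qsum big_map; apply: eq_bigr => q _ /=.
by rewrite cgqS_nil cgq_star1 mul1r mulr1.
Qed.

Lemma mon_cgqS s w : level (size w) s -> mon R A s * cgqS R A w =
  if cuts w s then cgqS R A (cut_word w s) * cgqU R A (cut_elt w s) else 0.
Proof.
case: s => [[[v g] w']|] /= ww'; last by rewrite mul0r.
case: ifPn => [/prefixP[z ->]|w'w].
  rewrite drop_size_cat// !cgqS_cat -mulrA (mulrA (cgq_star _)) cgqSVS mul1r.
  by rewrite -mulrA cgqUS mulrA.
rewrite -mulrA cgqSVS0 ?mulr0//; apply: contra w'w => /prefixP[z zE].
move: ww'; rewrite zE size_cat -{2}[size w]addn0 leq_add2l leqn0 => /nilP ->.
by rewrite cats0 prefix_refl.
Qed.

(** For |w| = n the product l s_w is the sum over v of s_v times the compression at v and w. If all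
    compressions vanished, so would every l s_w, and then l. *)
Lemma compress_neq0 n l : all (fun q => level n q.2) l -> qsum l <> 0 ->
  exists v w, size w = n /\ gsum (compress v w l) <> 0.
Proof.
move=> ll lN; apply: contrapT => H; apply: lN.
apply: (@cgq_eq0 _ _ _ _ n) => w wn.
pose V := undup [seq cut_word w q.2 | q <- l].
suff -> : qsum l * cgqS R A w = \sum_(v <- V) cgqS R A v * gsum (compress v w l).
  rewrite big1// => v _; suff -> : gsum (compress v w l) = 0 by rewrite mulr0.
  by apply: contrapT => vN; apply: H; exists v, w.
rewrite /qsum mulr_suml.
under [RHS]eq_bigr do
  rewrite /gsum /compress big_map big_filter big_mkcond /= mulr_sumr.
rewrite exchange_big /= big_seq [RHS]big_seq; apply: eq_bigr => -[k s] ls /=.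
rewrite cgq_scaleAl mon_cgqS; last by rewrite wn; have /allP/(_ _ ls) := ll.
case: ifPn => c /=; last by rewrite scaler0 big1// => v _; rewrite mulr0.
rewrite (bigD1_seq (cut_word w s)) ?undup_uniq//=; last first.
  by rewrite mem_undup; apply/mapP; exists (k, s).
rewrite eqxx cgq_scaleAr big1 ?addr0// => v.
by rewrite eq_sym => /negPf ->; rewrite mulr0.
Qed.

End Compression.

(** * Descent *)

Section Descent.
Variables (R : realType) (G : groupType) (X : finType) (A : selfSimilar G X).
Local Notation C := (R[i]).
Implicit Types (l : seq (C * isg G X)) (L : seq (C * G)) (v w : seq X)
  (s t : isg G X) (r : omega X).

Definition singular L := gsum A L <> 0 /\ ess A (emb X L).

(** For |v| = |w| these are the terms of s_v^* b s_w. Equal group elements are not merged, so the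
    order of the surviving terms is kept and their number can only drop. *)
Definition restrict v w L : seq (C * G) :=
  [seq (q.1, restr A q.2 w) | q <- L & actw A q.2 w == v].

Lemma compress_emb v w L : compress A v w (emb X L) = restrict v w L.
Proof.
rewrite /compress /emb filter_map -map_comp.
rewrite (@eq_filter _ _ (fun q => actw A q.2 w == v)).
  by apply: eq_map => q /=; rewrite drop0.
by move=> q /=; rewrite drop0 prefix0s.
Qed.

Lemma singular_compress n l : all (fun q => level n q.2) l ->
  qsum A l <> 0 -> ess A l ->
  exists v w, size w = n /\ singular (compress A v w l).
Proof.
move=> ll lN le; have [v [w [wn vw]]] := compress_neq0 ll lN.
by exists v, w; split => //; split => //; apply: compress_ess; rewrite ?wn.
Qed.

Lemma singular_restrict n L : singular L ->
  exists v w, size w = n /\ singular (restrict v w L).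
Proof.
move=> [LN Le]; have [||//|v [w [wn]]] := @singular_compress n (emb X L).
- by rewrite all_map; apply/allP.
- by rewrite qsum_emb.
by rewrite compress_emb; exists v, w.
Qed.

(** Left multiplication by u_h is invertible on C(G,X), and on functions it is composition with the
    homeomorphism taking the germ of t to the germ of u_(h^-1) t. *)
Lemma singular_translate h L : singular L ->
  singular [seq (q.1, (h * q.2)%g) | q <- L].
Proof.
move=> [LN Le]; split.
  move=> H; apply: LN; have := congr1 (fun b => cgqU R A h^-1%g * b) H.
  rewrite /gsum big_map mulr0 mulr_sumr => e; rewrite -[RHS]e; apply: eq_bigr => q _ /=.
  by rewrite cgq_scaleAr -cgqUM mulgA mulVg mul1g.
move=> t U oU Une Ut; pose t' := isgM A (isgu X h^-1%g) t.
have tt' q : idom t q -> idom t' q.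
  by move=> tq; apply/idomM; split => //; apply: idom_isgu.
have [|r Ur r0] := Le t' U oU Une; first by move=> q /Ut/tt'.
exists r => //; rewrite -[RHS]r0 /slsum /emb !big_map; apply: eq_bigr => -[k g] _ /=.
have tr := Ut _ Ur.
congr (_ * _); apply: indic_iff; rewrite !slice_germ//; last exact: tt'.
have d := idegM (tt' _ tr).
split=> -[_ _ dt gt]; split; try exact: idom_isgu; rewrite ?d//.
- exact: tt'.
- by rewrite -dt.
- apply: filterS2 gt (nbhs_idom (tt' _ tr)) => q gt t'q.
  by rewrite iactM// -gt !iact_isgu -actM mulgA mulVg mul1g.
- by move: dt; rewrite d /= => ->; rewrite add0r.
- apply: filterS2 gt (nbhs_idom (tt' _ tr)) => q gt t'q.
  by move: gt; rewrite iactM// !iact_isgu actM => ->; rewrite -actM mulgV act1.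
Qed.

Lemma restr_closed (N : set G) w g :
  (forall n x, N n -> N (restr1 A n x)) -> N g -> N (restr A g w).
Proof. by move=> NN; elim: w g => //= x w IH g gN; apply/IH/NN. Qed.

Lemma restr_nucleus (N : set G) L :
  (forall n x, N n -> N (restr1 A n x)) ->
  (forall g, exists m : nat, forall w, size w = m -> N (restr A g w)) ->
  exists m, forall w q, size w = m -> q \in L -> N (restr A q.2 w).
Proof.
move=> Nc Nr; elim: L => [|[k g] L [m mL]]; first by exists 0%N.
(* Depths of individual elements can be added because the nucleus is closed under restriction. *)
have [m' m'g] := Nr g; exists (m' + m)%N => w q wm.
rewrite inE => /predU1P[->|qL] /=.
  rewrite -(cat_take_drop m' w) restr_cat; apply: restr_closed => //.
  by apply: m'g; rewrite size_takel// wm leq_addr.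
rewrite -(cat_take_drop m w) restr_cat; apply: restr_closed => //.
by apply: mL => //; rewrite size_takel// wm leq_addl.
Qed.

Lemma pigeonhole (T : finType) (f : nat -> T) : exists i j, (i < j)%N /\ f i = f j.
Proof.
apply: contrapT => H.
suff /leq_card : injective (fun i : 'I_#|T|.+1 => f i) by rewrite card_ord ltnn.
move=> i j fij; apply/val_inj; case: (ltngtP i j) => // ij; exfalso; apply: H.
  by exists i, j.
by exists j, i.
Qed.

Lemma pigeonhole_seq (T : choiceType) (e : seq T) k (f : nat -> seq T) :
  (forall i, size (f i) = k /\ {subset f i <= e}) ->
  exists i j, (i < j)%N /\ f i = f j.
Proof.
move=> H.
(* A list is encoded by the table telling which element of e stands at which position; there are
   finitely many such tables. *)
have [i [j [ij /ffunP fij]]] := pigeonhole (fun i : nat =>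
  [ffun m : 'I_k => [ffun x : seq_sub e => nth (val x) (f i) m == val x]]).
exists i, j; split => //.
have [si fi] := H i; have [sj fj] := H j.
case: k si sj fij {H} => [/size0nil -> /size0nil -> //|k] si sj fij.
have x0 : T by case: (f i) si.
apply: (@eq_from_nth _ x0); rewrite ?sj// => m; rewrite si => mk.
have xe : nth x0 (f i) m \in e by apply/fi/mem_nth; rewrite si.
have := fij (Ordinal mk); rewrite !ffunE => /ffunP /(_ (SeqSub xe)).
rewrite !ffunE /=.
rewrite [nth _ (f i) _](set_nth_default x0) ?si// eqxx => /esym/eqP <-.
by apply: set_nth_default; rewrite sj.
Qed.

(* A list of minimal length among the singular lists supported in the nucleus
   loses no term under [restrict], so its whole orbit is obtained by
   restricting the group elements. *)
Lemma singular_periodic : contracting A -> (exists L, singular L) ->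
  exists L v w, [/\ singular L, w <> [::] &
    forall q, q \in L -> actw A q.2 w = v /\ restr A q.2 w = q.2].
Proof.
move=> [N [finN Nc Nr]] [L LS].
pose S k (L : seq (C * G)) :=
  [/\ size L = k, singular L & forall q, q \in L -> N q.2].
have [m mN] := restr_nucleus L Nc Nr.
have [v [w [wm L1S]]] := singular_restrict m LS.
have exS : exists k, `[< exists L, S k L >].
  exists (size (restrict v w L)); apply/asboolP; exists (restrict v w L).
  split => // q /mapP[q']; rewrite mem_filter => /andP[_ q'L] -> /=.
  exact: mN.
case: (ex_minnP exS) => k /asboolP[L0 S0] kmin {L LS m mN v w wm L1S exS}.
have step L : S k L -> exists vwL : seq X * seq X * seq (C * G),
    [/\ S k vwL.2, size vwL.1.2 = 1%N,
      vwL.2 = [seq (q.1, restr A q.2 vwL.1.2) | q <- L] &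
      forall q, q \in L -> actw A q.2 vwL.1.2 = vwL.1.1].
  move=> [sL SL NL]; have [v [w [w1 LS]]] := singular_restrict 1 SL.
  have NR q : q \in restrict v w L -> N q.2.
    move=> /mapP[q']; rewrite mem_filter => /andP[_ q'L] -> /=.
    by apply: restr_closed => //; apply: NL.
  (* Minimality of k shows that the filter in [restrict] rejects nothing, so every element of L maps
     w to v. *)
  have : (k <= size (restrict v w L))%N.
    by apply: kmin; apply/asboolP; exists (restrict v w L).
  rewrite size_map size_filter -sL => c.
  have : all (fun q => actw A q.2 w == v) L by rewrite all_count eqn_leq count_size.
  move=> Lv; have RE : restrict v w L = [seq (q.1, restr A q.2 w) | q <- L].
    by rewrite /restrict (all_filterP Lv).
  exists (v, w, restrict v w L); split => //=.
    by split => //; rewrite RE size_map.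
  by move=> q /(allP Lv) /eqP.
(* Working in this subtype keeps the invariant while the chosen one-letter restriction is
   iterated. *)
pose T := {L | S k L}.
have next_ex (z : T) : exists z' : T, exists v w, [/\ size w = 1%N,
    sval z' = [seq (q.1, restr A q.2 w) | q <- sval z] &
    forall q, q \in sval z -> actw A q.2 w = v].
  have [[[v w] L'] [/= S' w1 L'E vE]] := step _ (svalP z).
  by exists (exist _ L' S'), v, w.
have [next nextP] := choice next_ex.
pose F i := sval (iter i next (exist _ L0 S0)).
have FS i : S k (F i) by exact: svalP.
have Fadd i n : exists v w, [/\ size w = n,
    F (n + i)%N = [seq (q.1, restr A q.2 w) | q <- F i] &
    forall q, q \in F i -> actw A q.2 w = v].
  elim: n => [|n [v [w [wn FE vE]]]].
    by exists [::], [::]; split => //; rewrite add0n -[LHS]map_id; apply: eq_map => -[].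
  have [v' [w' [w1 FE' vE']]] := nextP (iter (n + i) next (exist _ L0 S0)).
  exists (v ++ v'), (w ++ w'); split.
  - by rewrite size_cat wn w1 addn1.
  - rewrite /F addSn /= FE' -/(F (n + i)) FE -map_comp; apply: eq_map => q /=.
    by rewrite restr_cat.
  - move=> q qF; rewrite actw_cat vE// (vE' (q.1, restr A q.2 w))//.
    by rewrite -/(F (n + i)) FE; apply: map_f.
have /finite_seqP[e Ne] := finN.
(* Only the group elements need to be compared: they form lists of fixed length k in the finite
   nucleus, while the coefficients never change. *)
have [i [j [ij Fij]]] : exists i j, (i < j)%N /\
    [seq q.2 | q <- F i] = [seq q.2 | q <- F j].
  apply: (@pigeonhole_seq _ e k) => i; have [Fk _ FN] := FS i.
  rewrite size_map; split => // _ /mapP[q qF ->].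
  by have := FN _ qF; rewrite Ne.
(* The letters used between the two equal stages spell w, which is nonempty because i < j;
   restricting to it returns each group element to itself. *)
have [v [w [wn FE vE]]] := Fadd i (j - i)%N.
rewrite subnK ?(ltnW ij)// in FE.
exists (F i), v, w; split; first by have [] := FS i.
  by move=> w0; move: wn; rewrite w0 /= => /esym/eqP; rewrite subn_eq0 leqNgt ij.
move=> q qF; split; first exact: vE.
move: Fij; rewrite FE -map_comp => /esym.
by move=> /eq_in_map /(_ q qF).
Qed.

End Descent.

(** * From formal sums to elements of the group algebra *)

Section GroupAlgebra.
Variables (R : realType) (G : groupType).
Local Notation C := (R[i]).
Implicit Types (L : seq (C * G)).

Definition collect L : grpalg G R :=
  [fsfun g in [fset q.2 | q in L]%fset => \sum_(q <- L | q.2 == g) q.1].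

Lemma collectE L g : collect L g = \sum_(q <- L | q.2 == g) q.1.
Proof.
rewrite fsfun_fun; case: ifPn => // gL.
rewrite big_seq_cond big1// => q /andP[qL /eqP qg].
by move: gL; rewrite -qg => /negP; case; apply/imfsetP; exists q.
Qed.

(** Merging equal group elements preserves every linear expression in the terms. The target is left
    general to cover both values in C(G,X) and scalar values of functions on germs. *)
Lemma sum_collect (V : lmodType C) (F : G -> V) L :
  \sum_(g <- finsupp (collect L)) collect L g *: F g = \sum_(q <- L) q.1 *: F q.2.
Proof.
set S := [fset q.2 | q in L]%fset.
have sub : (finsupp (collect L) `<=` S)%fset by exact: finsupp_sub.
rewrite (big_fset_incl _ sub) => [|g _ ]; last first.
  by rewrite memNfinsupp => /eqP ->; rewrite scale0r.
under eq_bigr do rewrite collectE big_mkcond scaler_suml.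
rewrite exchange_big /= big_seq [RHS]big_seq; apply: eq_bigr => q qL.
have qS : q.2 \in S by apply/imfsetP; exists q.
rewrite (bigD1_seq q.2) ?fset_uniq//= eqxx big1 ?addr0// => g.
by rewrite eq_sym => /negPf ->; rewrite scale0r.
Qed.

End GroupAlgebra.

Theorem proposition6p4 (R : realType) (G : groupType) (X : finType)
    (A : selfSimilar G X) :
  contracting A ->
  (exists p : cgx G X R, Iess_alg A p /\ ~ cgx_eq A p (C0 G X R)) ->
  exists (w : seq X) (a : grpalg G R),
    [/\ w <> [::], CH A w a, (exists g, a g <> 0)
      & Iess_alg A (grpalg_cgx X a)].
Proof.
move=> cA [p [pI pN]]; have [l [lp lf]] := cgx_normal_form A p.
(* Any bound on the lengths of the right-hand words of the terms will do. *)
have [n ln] : exists n, all (fun q : R[i] * isg G X => level n q.2) l.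
  elim: l {lp lf} => [|[k s] l [n /allP nl]]; first by exists 0%N.
  exists (maxn n (if s is Some (_, _, w) then size w else 0%N)) => /=.
  apply/andP; split; first by case: s => [[[v g] w]|] //=; apply: leq_maxr.
  apply/allP => q /nl; case: (q.2) => [[[v g] w]|] //= wn.
  exact: leq_trans wn (leq_maxl _ _).
have lN : qsum A l <> 0 by rewrite /qsum -lp => /cls_eq.
have [v0 [w0 [_ LS]]] := singular_compress ln lN (Iess_algP lf pI).
have exL : exists L : seq (R[i] * G), singular A L by exists (compress A v0 w0 l).
have [L [v [w [[LN Le] wN Lw]]]] := singular_periodic cA exL.
have [q0 q0L] : exists q, q \in L.
  case: L LN {Le Lw} => [|q L] LN; last by exists q; rewrite inE eqxx.
  by exfalso; apply: LN; rewrite /gsum big_nil.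
(* All elements of L send w to the same v and restrict to themselves there, so this translation
   brings v back to w and lands in H_w. *)
pose L' := [seq (q.1, (q0.2^-1 * q.2)%g) | q <- L].
have [L'N L'e] : singular A L' by apply: singular_translate.
pose a := collect L'; exists w, a; split => //.
- move=> g; rewrite collectE => ag.
  have [q qL' qg] : exists2 q, q \in L' & q.2 = g.
    apply: contrapT => H; move/eqP: ag; apply; rewrite big_seq_cond big1// => q.
    by move=> /andP[qL' /eqP qg]; exfalso; apply: H; exists q.
  move: qL' qg => /mapP[q' q'L -> /= <-]; rewrite /Hgrp /=.
  have [v1 r1] := Lw _ q'L; have [v2 r2] := Lw _ q0L.
  have [-> ->] := actw_restrM A q0.2^-1%g q'.2 w.
  by rewrite v1 -v2 actwVK restrV r2 r1.
(* The image of a in C(G,X) is that of L', which is nonzero, so a cannot vanish identically. *)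
- apply: contrapT => a0; apply: L'N; rewrite /gsum -sum_collect big1// => g _.
  suff -> : collect L' g = 0 by rewrite scale0r.
  by apply: contrapT => ag; apply: a0; exists g.
- have aE : cgx_fun (grpalg_cgx X a) =
      slsum (emb X [seq (a g, g) | g <- finsupp a]) :> (germs A -> _).
    by rewrite cgx_fun_grpalg /emb -map_comp.
  apply: (ess_Iess_alg aE); rewrite -/(emb X _) => t U oU Une Ut.
  have [r Ur r0] := L'e t U oU Une Ut; exists r => //; rewrite -[RHS]r0.
  rewrite /slsum /emb !big_map.
  (* The scalars are viewed as a module over themselves, so that a and L' are seen to define the
     same function on germs. *)
  have := sum_collect (V := (R[i])^o)
    (fun g => \1_(slice (isgu X g)) (germ A t r)) L'.
  by rewrite [RHS]big_map; apply.
Qed.
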